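(* Let $M,N$ lie on $1$-parameter subgroups $M^t,N^t$ of $\mathrm{GL}(n,\mathbf{R})$ (so $M=M^1$, $N=N^1$), and suppose that $\det M>1$ and $\det N>1$. If there exists a horizontal respecting quasi-isometry $\phi:G_M\to G_N$, then there exist real numbers $r,s>0$ such that $M^r$ and $N^s$ have the same absolute Jordan form.
   Context: Given a $1$-parameter subgroup $M^t$ of $\mathrm{GL}(n,\mathbf{R})$ with $M=M^1$, $G_M=\mathbf{R}^n\rtimes_M\mathbf{R}$ is the Lie group with underlying set $\mathbf{R}^n\times\mathbf{R}$ and multiplication $(x,t)\cdot(y,s)=(x+M^ty,\,t+s)$, equipped with the left invariant Riemannian metric which is the standard Euclidean metric at the identity; at $(x,t)$ this metric has matrix $\begin{pmatrix}Q_M(t)&0\\0&1\end{pmatrix}$ with $Q_M(t)=(M^{-t})^TM^{-t}$. The horizontal leaves of $G_M$ are the sets $P_t=\mathbf{R}^n\times\{t\}$, $t\in\mathbf{R}$; denote those of $G_N$ by $P'_t$. A map $f:X\to Y$ of metric spaces is a $(K,C)$ quasi-isometry ($K\ge 1$, $C\ge 0$) if $\frac1K d_X(x,x')-C\le d_Y(f(x),f(x'))\le K d_X(x,x')+C$ for all $x,x'\in X$ and every $y\in Y$ satisfies $d_Y(y,f(X))\le C$. A quasi-isometry $\phi:G_M\to G_N$ is horizontal respecting if there exist a function $h:\mathbf{R}\to\mathbf{R}$ and $A\ge 0$ such that the Hausdorff distance satisfies $d_{\mathcal H}(\phi(P_t),P'_{h(t)})\le A$ for all $t\in\mathbf{R}$.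 The absolute Jordan form of $M\in \mathrm{GL}(n,\mathbf{R})$ is the matrix obtained from the Jordan form of $M$ over $\mathbf{C}$ by replacing each diagonal entry by its absolute value and rearranging the Jordan blocks in a canonical order (by decreasing diagonal entry, and for equal diagonal entries by decreasing block size). *)

(* Defs.v *)
From HB Require Import structures.
From mathcomp Require Import all_boot all_order all_algebra.
From mathcomp Require Import all_classical all_reals all_analysis.
From mathcomp Require Import complex.

Set Implicit Arguments.
Unset Strict Implicit.
Unset Printing Implicit Defensive.

Import Order.TTheory GRing.Theory Num.Theory.
Import numFieldNormedType.Exports.

Local Open Scope classical_set_scope.
Local Open Scope ring_scope.

Definition one_param_subgroup (R : realType) (n : nat) (Mt : R -> 'M[R]_n) :=
  [/\ continuous Mt,
      (forall t, Mt t \in unitmx) &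
      (forall s t, Mt (s + t) = Mt s *m Mt t)].

Definition gm_carrier (R : realType) (n : nat) : Type := ('cV[R]_n * R)%type.

Definition gm_mul (R : realType) (n : nat) (Mt : R -> 'M[R]_n)
    (p q : gm_carrier R n) : gm_carrier R n :=
  (p.1 + Mt p.2 *m q.1, p.2 + q.2).

Definition gm_Q (R : realType) (n : nat) (Mt : R -> 'M[R]_n) (t : R) : 'M[R]_n :=
  (Mt (- t))^T *m Mt (- t).

(* The norm of the tangent vector [v] at [p], for the metric whose matrix at
   [(x, t)] is [block_mx (gm_Q Mt t) 0 0 1]. *)
Definition gm_norm (R : realType) (n : nat) (Mt : R -> 'M[R]_n)
    (p v : 'cV[R]_n * R) : R :=
  Num.sqrt ((v.1^T *m gm_Q Mt p.2 *m v.1) 0 0 + v.2 ^+ 2).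

Lemma one_param_subgroup0 (R : realType) (n : nat) (Mt : R -> 'M[R]_n) :
  one_param_subgroup Mt -> Mt 0 = 1%:M.
Proof.
move=> [_ Mu MD]; have := MD 0 0; rewrite addr0 => M00.
by apply: (can_inj (mulKmx (Mu 0))); rewrite mulmx1 -M00.
Qed.

Lemma gm_norm_id (R : realType) (n : nat) (Mt : R -> 'M[R]_n)
    (v : 'cV[R]_n * R) : one_param_subgroup Mt ->
  gm_norm Mt (0, 0) v = Num.sqrt (\sum_i v.1 i 0 ^+ 2 + v.2 ^+ 2).
Proof.
move=> hM; rewrite /gm_norm /gm_Q oppr0 (one_param_subgroup0 hM).
rewrite trmx1 !mulmx1 mxE; congr (Num.sqrt (_ + _)).
by apply: eq_bigr => i _; rewrite mxE expr2.
Qed.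

(* Left translation by [p] is affine, with linear part
   [v |-> (Mt p.2 *m v.1, v.2)]. *)
Lemma gm_norm_left_invariant (R : realType) (n : nat) (Mt : R -> 'M[R]_n)
    (p q : gm_carrier R n) (v : 'cV[R]_n * R) : one_param_subgroup Mt ->
  gm_norm Mt (gm_mul Mt p q) (Mt p.2 *m v.1, v.2) = gm_norm Mt q v.
Proof.
move=> hM; have [_ _ MD] := hM; rewrite /gm_norm /gm_Q /=.
have -> : Mt (- (p.2 + q.2)) = Mt (- q.2) *m Mt (- p.2).
  by rewrite -MD opprD addrC.
have MV : Mt (- p.2) *m Mt p.2 = 1%:M.
  by rewrite -MD addNr one_param_subgroup0.
have quadE (A : 'M[R]_n) (u : 'cV[R]_n) :
    u^T *m (A^T *m A) *m u = (A *m u)^T *m (A *m u).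
  by rewrite trmx_mul !mulmxA.
by rewrite !quadE -mulmxA (mulmxA (Mt (- p.2))) MV mul1mx.
Qed.

Definition C1 (R : realType) (V : normedModType R) (g : R -> V) :=
  (forall u, derivable g u 1) /\ continuous (derive1 g).

(* [c] is C^1 up to the endpoints on each closed piece of some partition of
   [a, b]; since consecutive pieces share an endpoint, [c] is continuous on
   [a, b]. *)
Definition piecewise_C1 (R : realType) (V : normedModType R) (a b : R)
    (c : R -> V) :=
  exists2 s : seq R, itv_partition a b s &
    forall i, (i < size s)%N ->
      exists2 g : R -> V, C1 g & {in `[nth b (a :: s) i, nth b s i], c =1 g}.

(* The derivative below may be meaningless at the finitely many break points,
   which do not affect the integral. *)
Definition gm_length (R : realType) (n : nat) (Mt : R -> 'M[R]_n)
    (c : R -> 'cV[R]_n * R) : R :=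
  \int[@lebesgue_measure R]_(u in `[0, 1]) gm_norm Mt (c u) (derive1 c u).

Definition gm_dist (R : realType) (n : nat) (Mt : R -> 'M[R]_n)
    (p q : gm_carrier R n) : R :=
  inf [set gm_length Mt c | c in
        [set c : R -> 'cV[R]_n * R |
          [/\ piecewise_C1 0 1 c, c 0 = p & c 1 = q]]].

Definition gm_leaf (R : realType) (n : nat) (t : R) : set (gm_carrier R n) :=
  [set p | p.2 = t].
Arguments gm_leaf {R} n t.

Definition set_dist (R : realType) (X : Type) (d : X -> X -> R)
    (x : X) (A : set X) : \bar R :=
  ereal_inf [set (d x a)%:E | a in A].

Definition hausdorff_dist (R : realType) (X : Type) (d : X -> X -> R)
    (A B : set X) : \bar R :=
  maxe (ereal_sup [set set_dist d a B | a in A])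
       (ereal_sup [set set_dist d b A | b in B]).

Definition quasi_isometry_with (R : realType) (X Y : Type)
    (dX : X -> X -> R) (dY : Y -> Y -> R) (K C : R) (f : X -> Y) :=
  [/\ 1 <= K, 0 <= C,
      (forall x x', K^-1 * dX x x' - C <= dY (f x) (f x')
                      <= K * dX x x' + C) &
      (forall y, set_dist dY y (range f) <= C%:E)%E].

Definition quasi_isometry (R : realType) (X Y : Type)
    (dX : X -> X -> R) (dY : Y -> Y -> R) (f : X -> Y) :=
  exists K C : R, quasi_isometry_with dX dY K C f.

Definition horizontal_respecting (R : realType) (n : nat)
    (Nt : R -> 'M[R]_n) (phi : gm_carrier R n -> gm_carrier R n) :=
  exists (h : R -> R) (A : R), 0 <= A /\
    forall t, (hausdorff_dist (gm_dist Nt) (phi @` gm_leaf n t) (gm_leaf n (h t))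
                 <= A%:E)%E.

Definition jordan_block (F : nzRingType) (a : F) (k : nat) : 'M[F]_k :=
  \matrix_(i, j) (a *+ (i == j) + (i.+1 == j :> nat)%:R).

(* A pair [(a, k)] in [s] stands for the Jordan block of size [k] and diagonal
   entry [a]. *)
Definition jordan_mx (F : nzRingType) (s : seq (F * nat)) :
    'M[F]_(\sum_(i < size s) (tnth (in_tuple s) i).2) :=
  \mxdiag_(i < size s)
    jordan_block (tnth (in_tuple s) i).1 (tnth (in_tuple s) i).2.

Definition is_jordan_mx (F : nzRingType) (n : nat) (J : 'M[F]_n)
    (s : seq (F * nat)) :=
  all (fun b => 0 < b.2)%N s /\
  exists e : (\sum_(i < size s) (tnth (in_tuple s) i).2)%N = n,
    J = castmx (e, e) (jordan_mx s).

Definition jordan_form_of (F : fieldType) (n : nat) (M J : 'M[F]_n)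
    (s : seq (F * nat)) :=
  is_jordan_mx J s /\ M ~_{in unitmx} J.

Definition block_geq (R : realType) (b1 b2 : R * nat) : bool :=
  (b2.1 < b1.1) || ((b2.1 == b1.1) && (b2.2 <= b1.2)%N).

Definition absolute_jordan_form (R : realType) (n : nat) (M J : 'M[R]_n) :=
  exists (JC : 'M[R[i]]_n) (s : seq (R[i] * nat)),
    jordan_form_of (map_mx (real_complex R) M) JC s /\
    is_jordan_mx J (sort (@block_geq R) [seq (Normc.normc b.1, b.2) | b <- s]).

Definition same_absolute_jordan_form (R : realType) (n : nat)
    (M N : 'M[R]_n) :=
  exists J : 'M[R]_n, absolute_jordan_form M J /\ absolute_jordan_form N J.

(* Main.v *)
Require Import Defs.
From mathcomp Require Import all_boot all_order all_algebra.
From mathcomp Require Import all_classical all_reals all_analysis.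
From mathcomp Require Import measurable_realfun perm spectral complex.
From mathcomp Require Import zify ring lra.

Set Implicit Arguments.
Unset Strict Implicit.
Unset Printing Implicit Defensive.

Import Order.TTheory GRing.Theory Num.Theory.
Import numFieldNormedType.Exports.
Import Normc.
Local Open Scope classical_set_scope.
Local Open Scope ring_scope.

(** Write |.| for the sup norm on R^n. The path metric of the leaf at height t
    of G_M is |M^(-t)(x - x')| up to a constant, so a horizontal respecting
    quasi-isometry phi restricts to maps f_t of R^n that distort
    |M^(-t)(x - x')| into |N^(-h(t))(y - y')| with multiplicative and additive
    constants independent of t (leaf_map_proper and
    coarse_lipschitz_of_unit_steps). For a fixed t, f_t and f_0 differ by a
    bounded amount, because (x, t) and (x, 0) are at bounded distance. Hence the
    single map f = f_0 distorts all these norms, with a common factor K and an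
    additive error E_t (coarse_leaf_map).

    The additive errors disappear in the asymptotic cone of R^n: the limit
    F(x) = lim f(k x) / k along an ultrafilter is a bijection for which
      |N^(-h(t))(F x - F x')|  and  |M^(-t)(x - x')|
    agree up to the factor K for all t at once (scaling_limit). This replaces
    the coarse geometry by exact inequalities, and it treats the expanding, the
    contracting and the central directions alike.

    A map between R^n with the norms |A .| and |B .| that is Lipschitz, and
    expanding for the standard norm, forces |det B| <= C |det A|, by counting
    small cells (det_le_of_lipschitz). Applied to F and its inverse for every
    t, this gives h(t) = m t + O(1) with m = ln det M / ln det N, which is
    positive since both determinants exceed 1 (height_change_affine). So, after
    the substitution of N^m for N, the powers satisfy
    |N^j (F x - F x')| ~ |M^j (x - x')| for all j >= 0.

    Therefore F maps cosets of
    V(lam, k) = {v : |M^j v| = O(lam^j (j+1)^(k-1))} into cosets of the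
    corresponding subspace for N. The same determinant estimate, applied to
    linear maps stretched by a large factor transversally to these subspaces,
    shows that their dimensions agree (mxrank_le_of_lipschitz). By the explicit
    formula for powers along a Jordan chain, the codimension of V(lam, k) is
    the number of basis vectors of a Jordan basis that belong to an eigenvalue
    of modulus > lam, or lie at position >= k of a chain for an eigenvalue of
    modulus lam (growth_space). A second difference in k then counts the blocks
    of each modulus and size, so the absolute Jordan forms coincide
    (perm_eq_of_tail_size). *)

(** * Sup norms and counting cells *)

Lemma mx_norm_leP (R : realType) m n (x : 'M[R]_(m, n)) (r : R) : 0 <= r ->
  reflect (forall i j, `|x i j| <= r) (`|x| <= r).
Proof.
move=> r0; rewrite -[`|x|]/(mx_norm x) mx_normrE.
apply: (iffP (bigmax_leP _ _ _ _)) => [[_ H] i j|H]; first exact: (H (i, j)).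
by split=> // -[i j] _ /=.
Qed.

Lemma ler_entry_norm (R : realType) m n (x : 'M[R]_(m, n)) i j :
  `|x i j| <= `|x|.
Proof. by have /mx_norm_leP := lexx `|x|; apply. Qed.

Lemma mulmx_norm_le (R : realType) m n p (A : 'M[R]_(m, n)) (x : 'M[R]_(n, p)) :
  `|A *m x| <= n%:R * `|A| * `|x|.
Proof.
apply/mx_norm_leP => [|i j]; first by rewrite !mulr_ge0.
rewrite mxE (le_trans (ler_norm_sum _ _ _))//.
rewrite -mulrA -[n in n%:R]card_ord mulr_natl -sumr_const; apply: ler_sum => k _.
by rewrite normrM ler_pM// ler_entry_norm.
Qed.

Lemma col_mx_norm_le (R : realType) m1 m2 n (x : 'M[R]_(m1, n))
    (y : 'M[R]_(m2, n)) (r : R) : 0 <= r ->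
  (`|col_mx x y| <= r) = (`|x| <= r) && (`|y| <= r).
Proof.
move=> r0; apply/mx_norm_leP/andP => // [H|[/(mx_norm_leP _ r0) Hx /(mx_norm_leP _ r0) Hy] i j].
  split; apply/mx_norm_leP => // i j.
    by have := H (lshift _ i) j; rewrite col_mxEu.
  by have := H (rshift _ i) j; rewrite col_mxEd.
by rewrite mxE; case: (fintype.split i) => k; [apply: Hx|apply: Hy].
Qed.

(** A grid of mesh |d| delta on the segment [- 2 rho, 2 rho]; the index is junk
    outside of it. *)
Lemma line_cells (R : realType) (d rho delta : R) :
  d != 0 -> 0 < rho -> 0 < delta -> `|d| * delta <= rho ->
  exists (N : nat) (c : R -> 'I_N),
    N%:R * `|d| * delta <= 5 * rho /\
    forall u u', `|u| <= 2 * rho -> `|u'| <= 2 * rho -> c u = c u' ->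
      `|u - u'| <= `|d| * delta.
Proof.
move=> d0 rho0 delta0 hd; set e := `|d| * delta.
have e0 : 0 < e by rewrite mulr_gt0// normr_gt0.
pose k u := Num.truncn ((u + 2 * rho) / e).
pose N := (Num.truncn (4 * rho / e)).+1.
have le4 : 0 <= 4 * rho / e by rewrite divr_ge0 ?ltW// mulr_gt0.
exists N, (fun u => inord (k u)); split.
  rewrite -mulrA -/e -ler_pdivlMr// /N -addn1 natrD.
  have -> : 5 * rho / e = 4 * rho / e + rho / e by field; rewrite gt_eqF.
  by rewrite lerD ?truncn_le// ler_pdivlMr// mul1r.
have kN u : `|u| <= 2 * rho -> (k u < N)%N.
  rewrite ler_norml => /andP[u1 u2]; rewrite ltnS; apply: le_truncn.
  by rewrite ler_pM2r ?invr_gt0//; lra.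
have kE u : `|u| <= 2 * rho -> (k u)%:R * e <= u + 2 * rho < (k u).+1%:R * e.
  rewrite ler_norml => /andP[u1 u2].
  rewrite -ler_pdivlMr// -ltr_pdivrMr//; apply: truncn_itv.
  by apply: divr_ge0; [lra|exact: ltW].
move=> u u' hu hu' /(congr1 val); rewrite /= !inordK ?kN// => ek.
move: (kE _ hu) (kE _ hu'); rewrite -ek -natr1 mulrDl mul1r.
move=> /andP[a1 a2] /andP[b1 b2]; rewrite ler_norml; apply/andP; split; lra.
Qed.

(** Up to a constant the box {|S z| <= rho} has volume rho^n / |det S|, and
    boxes of small diameter delta cover it without waste. The proof is Gaussian
    elimination with partial pivoting: taking the largest entry of the first
    column as pivot d keeps the multipliers at most 1, so the Schur complement
    S2 again satisfies |S2 z'| <= 2 rho, and |det S| = |d| |det S2|. The last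
    n coordinates are put in cells by induction, and the first one by a grid on
    the line after replacing them by a representative of their cell. *)
Lemma cell_count (R : realType) n : exists2 C : R, 0 < C &
  forall (S : 'M[R]_n) (rho : R), S \in unitmx -> 0 < rho ->
  exists2 delta0 : R, 0 < delta0 & forall delta : R, 0 < delta -> delta <= delta0 ->
  exists (X : finType) (c : 'cV[R]_n -> X),
    #|X|%:R * `|\det S| * delta ^+ n <= C * rho ^+ n /\
    forall z z', `|S *m z| <= rho -> `|S *m z'| <= rho -> c z = c z' ->
      `|z - z'| <= delta.
Proof.
elim: n => [|n [C C0 IH]].
  exists 1 => // S rho _ rho0; exists 1 => // delta delta0 _.
  exists unit, (fun=> tt); split; first by rewrite card_unit det_mx00 normr1 !expr0 !mulr1.
  by move=> z z' _ _ _; rewrite [z - z']flatmx0 normr0 ltW.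
exists (C * 2 ^+ n * 5); first by rewrite !mulr_gt0// exprn_gt0.
move=> S rho Su rho0.
pose i0 := [arg max_(i > ord0) `|S i 0|]%O.
have maxi0 i : `|S i 0| <= `|S i0 0|.
  by rewrite /i0; case: arg_maxP => // j _; apply.
pose d := S i0 0.
have d0 : d != 0.
  apply/eqP => d0; have S0 : S *m delta_mx (0 : 'I_n.+1) (0 : 'I_1) = 0.
    rewrite -colE; apply/matrixP => i j; rewrite !mxE; apply/eqP.
    by rewrite -normr_le0 (le_trans (maxi0 i))// -/d d0 normr0.
  move: (congr1 (mulmx (invmx S)) S0); rewrite mulKmx// mulmx0.
  by move/matrixP/(_ 0 0); rewrite !mxE !eqxx => /eqP; rewrite oner_eq0.
pose S1 : 'M[R]_(1 + n) := xrow ord0 i0 S.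
have S1norm (z : 'cV[R]_(1 + n)) : `|S *m z| <= rho -> `|S1 *m z| <= rho.
  move=> /(mx_norm_leP _ (ltW rho0)) H; apply/mx_norm_leP => [|i j].
    exact: ltW.
  have := H (tperm ord0 i0 i) j; rewrite !mxE; congr (`|_| <= _).
  by apply: eq_bigr => k _; rewrite !mxE.
pose t : 'M[R]_(1, n) := ursubmx S1.
pose u : 'M[R]_(n, 1) := d^-1 *: dlsubmx S1.
pose S2 : 'M[R]_n := drsubmx S1 - u *m t.
have S1E : S1 = block_mx d%:M t (d *: u) (S2 + u *m t).
  rewrite /S2 subrK /u scalerA divff// scale1r /t -[LHS]submxK.
  congr block_mx; apply/matrixP => i j.
  by rewrite !mxE !ord1 eqxx mulr1n lshift0 tpermL.
have u1 : `|u| <= 1.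
  apply/mx_norm_leP => // i j; rewrite !mxE normrM normfV mulrC.
  rewrite ler_pdivrMr ?normr_gt0// mul1r !ord1.
  by rewrite (le_trans _ (maxi0 (tperm ord0 i0 (rshift 1 i))))// lshift0.
have detS : `|\det S| = `|d| * `|\det S2|.
  have -> : `|\det S| = `|\det S1|.
    by rewrite /S1 xrowE det_mulmx det_perm normrM normrX normrN1 expr1n mul1r.
  have -> : S1 = block_mx 1%:M 0 u 1%:M *m block_mx d%:M t 0 S2.
    by rewrite S1E mulmx_block !mul1mx !mul0mx !addr0 mul_mx_scalar addrC.
  rewrite det_mulmx det_lblock det_ublock !det1 !mul1r det_scalar1.
  by rewrite normrM.
have S2u : S2 \in unitmx.
  move: Su; rewrite !unitmxE !unitfE -normr_eq0 detS mulf_eq0 !normr_eq0.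
  by rewrite negb_or => /andP[].
have S1z (z : 'cV[R]_(1 + n)) : S1 *m z =
    col_mx (d *: usubmx z + t *m dsubmx z)
           (u *m (d *: usubmx z + t *m dsubmx z) + S2 *m dsubmx z).
  rewrite -{1}[z]vsubmxK S1E mul_block_col mul_scalar_mx; congr col_mx.
  by rewrite mulmxDl mulmxDr -scalemxAl -scalemxAr mulmxA addrA addrAC.
have bnd (z : 'cV[R]_(1 + n)) : `|S *m z| <= rho ->
    `|d *: usubmx z + t *m dsubmx z| <= rho /\ `|S2 *m dsubmx z| <= 2 * rho.
  move=> /S1norm; rewrite S1z col_mx_norm_le ?(ltW rho0)// => /andP[h1 h2].
  split => //; set w := d *: _ + _ in h1 h2.
  have -> : S2 *m dsubmx z = (u *m w + S2 *m dsubmx z) - u *m w.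
    by rewrite addrC addKr.
  rewrite (le_trans (ler_normB _ _))// mulr_natl mulr2n lerD//.
  rewrite (le_trans (mulmx_norm_le _ _))// mul1r (le_trans _ h1)//.
  by rewrite ler_piMl.
have rho20 : 0 < 2 * rho by rewrite mulr_gt0.
have [delta1 delta10 {}IH] := IH S2 _ S2u rho20.
pose T := n%:R * `|t| + 1.
have T0 : 0 < T by rewrite ltr_wpDl// mulr_ge0.
exists (Num.min delta1 (Num.min (rho / `|d|) (rho / T))).
  by rewrite !lt_min delta10 !divr_gt0// normr_gt0.
move=> delta delta0; rewrite !le_min => /and3P[h1 h2 h3].
have [X [c [cX cP]]] := IH _ delta0 h1.
rewrite ler_pdivlMr ?normr_gt0// mulrC in h2.
rewrite ler_pdivlMr// mulrC in h3.
have [N [c1 [c1N c1P]]] := line_cells d0 rho0 delta0 h2.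
(* The grid for the first coordinate must depend only on the cell of the others. *)
pose rep k := xget 0 [set z' | c z' = k /\ `|S2 *m z'| <= 2 * rho]%classic.
pose val1 (z : 'cV[R]_(1 + n)) := (d *: usubmx z + t *m rep (c (dsubmx z))) 0 0.
exists (X * 'I_N)%type, (fun z : 'cV[R]_(1 + n) => (c (dsubmx z), c1 (val1 z))); split.
  rewrite card_prod card_ord natrM detS exprSr.
  have -> : #|X|%:R * N%:R * (`|d| * `|\det S2|) * (delta ^+ n * delta) =
     (#|X|%:R * `|\det S2| * delta ^+ n) * (N%:R * `|d| * delta) by ring.
  have -> : C * 2 ^+ n * 5 * rho ^+ n.+1 = (C * (2 * rho) ^+ n) * (5 * rho).
    by rewrite exprMn exprSr; ring.
  by rewrite ler_pM// !mulr_ge0// ?exprn_ge0// ltW.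
have repP (z : 'cV[R]_(1 + n)) : `|S *m z| <= rho ->
    `|dsubmx z - rep (c (dsubmx z))| <= delta.
  move=> /bnd[_ hz].
  have [] : [set z' | c z' = c (dsubmx z) /\ `|S2 *m z'| <= 2 * rho]%classic
      (rep (c (dsubmx z))) by apply: xgetPex; exists (dsubmx z).
  by move=> e hr; apply: cP.
have valP (z : 'cV[R]_(1 + n)) : `|S *m z| <= rho -> `|val1 z| <= 2 * rho.
  move=> hz; have [hz1 _] := bnd _ hz.
  apply: le_trans (ler_entry_norm _ _ _) _.
  have -> : d *: usubmx z + t *m rep (c (dsubmx z)) =
    (d *: usubmx z + t *m dsubmx z) - t *m (dsubmx z - rep (c (dsubmx z))).
    by rewrite mulmxBr opprB addrA addrAC addrK.
  rewrite (le_trans (ler_normB _ _))// mulr_natl mulr2n lerD//.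
  rewrite (le_trans (mulmx_norm_le _ _))// (le_trans _ h3)// ler_pM ?repP//.
  by rewrite lerDl.
move=> z z'; move: (z : 'cV[R]_(1 + n)) (z' : 'cV[R]_(1 + n)) => {}z {}z'.
move=> hz hz' [ec ec1].
have -> : z - z' = col_mx (@usubmx _ 1 n _ z - @usubmx _ 1 n _ z')
                          (@dsubmx _ 1 n _ z - @dsubmx _ 1 n _ z').
  by rewrite -add_col_mx -opp_col_mx !vsubmxK.
refine (etrans (@col_mx_norm_le _ 1 n _ _ _ _ (ltW delta0)) _).
apply/andP; split; last by apply: cP => //; [have [] := bnd _ hz|have [] := bnd _ hz'].
have := c1P _ _ (valP _ hz) (valP _ hz') ec1.
have -> : val1 z - val1 z' = d * (usubmx z - usubmx z') 0 0.
  by rewrite /val1 ec !mxE; ring.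
rewrite normrM ler_pM2l ?normr_gt0// => h.
apply/mx_norm_leP => [|i j]; first exact: ltW.
by rewrite (ord1 i) (ord1 j).
Qed.

(** * Lipschitz maps and determinants *)

Lemma natr_dist_lt1 (R : realType) (a b : nat) :
  `|a%:R - b%:R| < 1 :> R -> a = b.
Proof.
rewrite -[a%:R]/((Posz a)%:~R) -[b%:R]/((Posz b)%:~R).
rewrite -rmorphB /= -intr_norm -[1]/(1%:~R) ltr_int.
lia.
Qed.

(** Volume comparison by counting. The L^n points of a grid in the unit cube
    fall into at most C |det A| / eta^n cells of A-size eta. Within one such
    cell the images lie in a B-box of size K eta, and they are separated because
    F is expanding, so there are at most C (eta L)^n / |det B| of them, where C
    depends only on n and K. In the product L and eta cancel. *)
Lemma det_le_of_lipschitz (R : realType) n (K : R) : 0 < K ->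
  exists2 C : R, 0 < C &
  forall (A B : 'M[R]_n) (F : 'cV[R]_n -> 'cV[R]_n),
    A \in unitmx -> B \in unitmx ->
    (forall x x', `|x - x'| <= K * `|F x - F x'|) ->
    (forall x x', `|B *m (F x - F x')| <= K * `|A *m (x - x')|) ->
    `|\det B| <= C * `|\det A|.
Proof.
move=> K0; have [C0 C00 HC] := cell_count R n.
exists (C0 * C0 * K ^+ n * (2 * K) ^+ n).
  by rewrite !mulr_gt0// exprn_gt0// mulr_gt0.
move=> A B F Au Bu Fexp Flip.
have Aiu : invmx A \in unitmx by rewrite unitmx_inv.
have [eta eta0 {}/(_ eta eta0 (lexx _))[XA [cA [XAle cAP]]]] :=
  HC _ _ Aiu ltr01.
have Keta0 : 0 < K * eta by rewrite mulr_gt0.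
have [delta2 delta20 H2] := HC _ _ Bu Keta0.
(* The mesh 1/L makes images of distinct grid points more than delta apart. *)
pose L := (Num.truncn (2 * K * delta2)^-1).+1.
pose delta := (2 * K * L%:R)^-1.
have L0 : 0 < L%:R :> R by rewrite ltr0n.
have delta0 : 0 < delta by rewrite invr_gt0 !mulr_gt0.
have deltale : delta <= delta2.
  have := truncnS_gt (2 * K * delta2)^-1; rewrite -/L.
  rewrite -div1r ltr_pdivrMr ?mulr_gt0// => /ltW h.
  by rewrite /delta -div1r ler_pdivrMr ?mulr_gt0//; congr (_ <= _): h; ring.
have {H2} [XB [cB [XBle cBP]]] := H2 _ delta0 deltale.
pose pt (g : {ffun 'I_n -> 'I_L}) : 'cV[R]_n := \col_i ((g i)%:R / L%:R).
have pt1 g : `|pt g| <= 1.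
  apply/mx_norm_leP => // i j; rewrite mxE ger0_norm ?divr_ge0//.
  by rewrite ler_pdivrMr// mul1r ler_nat ltnW.
pose rep k := xget 0 [set x : 'cV[R]_n | `|x| <= 1 /\ cA (A *m x) = k]%classic.
have repP g : `|rep (cA (A *m pt g))| <= 1 /\
    cA (A *m rep (cA (A *m pt g))) = cA (A *m pt g).
  suff : [set x : 'cV[R]_n | `|x| <= 1 /\ cA (A *m x) = cA (A *m pt g)]%classic
    (rep (cA (A *m pt g))) by [].
  by apply: xgetPex; exists (pt g).
pose cell g := (cA (A *m pt g), cB (F (pt g) - F (rep (cA (A *m pt g))))).
have BF g : `|B *m (F (pt g) - F (rep (cA (A *m pt g))))| <= K * eta.
  have [r1 r2] := repP g.
  rewrite (le_trans (Flip _ _))// ler_pM2l// mulmxBr; apply: cAP => //.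
  - by rewrite mulKmx.
  - by rewrite mulKmx.
have cell_inj : injective cell.
  move=> g g' [e1 e2]; have := cBP _ _ (BF g) (BF g') e2.
  rewrite -e1 opprB addrA subrK => dF.
  have dpt : `|pt g - pt g'| <= (2 * L%:R)^-1.
    apply: le_trans (Fexp _ _) _; rewrite -ler_pdivlMl//.
    by apply: le_trans dF _; rewrite /delta !invfM mulrCA mulrA lexx.
  apply/ffunP => i; apply/val_inj => /=; apply/eqP.
  have : `|(g i)%:R - (g' i)%:R| < 1 :> R.
    have := le_trans (ler_entry_norm _ i 0) dpt.
    rewrite !mxE -mulrBl normrM [`|_^-1|]ger0_norm ?invr_ge0 ?ler0n//.
    rewrite ler_pdivrMr// => /le_lt_trans; apply.
    by rewrite invfM -mulrA mulVf ?gt_eqF// mulr1 invf_lt1// ltr1n.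
  by move/natr_dist_lt1/eqP.
have := leq_card _ cell_inj; rewrite card_ffun !card_ord card_prod.
rewrite -(ler_nat R) natrX natrM => cardle.
rewrite det_inv normfV expr1n mulr1 in XAle.
have dA : 0 < `|\det A| by rewrite normr_gt0 -unitfE -unitmxE.
have {}XAle : #|XA|%:R * eta ^+ n <= C0 * `|\det A|.
  by rewrite -ler_pdivrMr// mulrAC.
have : `|\det B| * (L%:R * delta * eta) ^+ n
    <= C0 * `|\det A| * (C0 * (K * eta) ^+ n).
  have [eta_ge0 delta_ge0] := (ltW eta0, ltW delta0).
  apply: le_trans (ler_pM _ _ XAle XBle); rewrite ?mulr_ge0 ?exprn_ge0//.
  rewrite !exprMn.
  have -> : #|XA|%:R * eta ^+ n * (#|XB|%:R * `|\det B| * delta ^+ n) =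
    `|\det B| * (#|XA|%:R * #|XB|%:R * delta ^+ n * eta ^+ n) by ring.
  by rewrite ler_wpM2l// !ler_wpM2r// exprn_ge0.
have -> : L%:R * delta * eta = (2 * K)^-1 * eta.
  by rewrite /delta; field; rewrite !gt_eqF.
rewrite [((2 * K)^-1 * eta) ^+ n]exprMn.
rewrite [(K * eta) ^+ n]exprMn !mulrA.
rewrite ler_pM2r ?exprn_gt0// exprVn ler_pdivrMr ?exprn_gt0 ?mulr_gt0//.
by congr (_ <= _); ring.
Qed.

(** * Lipschitz maps and codimensions *)

Lemma mul_pid_mxE (R : realType) n p r (w : 'M[R]_(n, p)) i j :
  ((pid_mx r : 'M[R]_n) *m w) i j = (i < r)%:R * w i j.
Proof.
rewrite mxE (bigD1 i)//= big1 => [|k ki].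
  by rewrite addr0 mxE eqxx.
by rewrite mxE val_eqE eq_sym (negPf ki) mul0r.
Qed.

Lemma pid_mx_norm_le (R : realType) n p r (w : 'M[R]_(n, p)) :
  `|(pid_mx r : 'M[R]_n) *m w| <= `|w|.
Proof.
apply/mx_norm_leP => // i j; rewrite mul_pid_mxE normrM normr_nat.
by rewrite (le_trans _ (ler_entry_norm w i j))// ler_piMl// lern1 leq_b1.
Qed.

Definition dilation (R : realType) n r (tau : R) : 'M[R]_n :=
  diag_mx (\row_i (if (i < r)%N then tau else 1)).

Lemma det_dilation (R : realType) n r (tau : R) : (r <= n)%N ->
  \det (dilation n r tau) = tau ^+ r.
Proof.
move=> rn; rewrite det_diag.
transitivity (\prod_(i < n | (i < r)%N) tau).
  by rewrite [RHS]big_mkcond /=; apply: eq_bigr => i _; rewrite mxE.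
by rewrite -(big_ord_widen n (fun=> tau) rn) prodr_const card_ord.
Qed.

Lemma mul_dilation (R : realType) n p r (tau : R) (w : 'M[R]_(n, p)) :
  dilation n r tau *m w = w + (tau - 1) *: ((pid_mx r : 'M[R]_n) *m w).
Proof.
apply/matrixP => i j; rewrite mul_diag_mx mxE [RHS]mxE [X in _ = _ + X]mxE mul_pid_mxE mxE.
by case: ltnP => _ /=; rewrite ?mulr1n ?mulr0n; ring.
Qed.

Lemma dilation_norm_ge (R : realType) n p r (tau : R) (w : 'M[R]_(n, p)) :
  1 <= tau ->
  `|w| <= `|dilation n r tau *m w| /\
  tau * `|(pid_mx r : 'M[R]_n) *m w| <= `|dilation n r tau *m w|.
Proof.
move=> tau1; have tau0 : 0 < tau by exact: lt_le_trans tau1.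
have le_entry i j : `|w i j| <= `|dilation n r tau *m w|.
  apply: le_trans (ler_entry_norm _ i j); rewrite mul_diag_mx !mxE normrM.
  by case: ltnP => _; rewrite ?normr1 ?mul1r// ler_peMl// ger0_norm// ltW.
split; first by apply/mx_norm_leP.
rewrite -ler_pdivlMl//; apply/mx_norm_leP => [|i j].
  by rewrite mulr_ge0// invr_ge0 ltW.
rewrite ler_pdivlMl// mul_pid_mxE.
apply: le_trans (ler_entry_norm _ i j); rewrite mul_diag_mx !mxE !normrM.
case: ltnP => _; first by rewrite normr1 mul1r (gtr0_norm tau0).
by rewrite normr0 mul0r mulr0 mulr_ge0.
Qed.

(** U factors through pid_mx with the invertible outer factors col_ebase and
    row_ebase, so its kernel becomes a coordinate subspace. *)
Lemma mulmx_eq0_pid (F : fieldType) m n p (U : 'M[F]_(m, n)) (v : 'M[F]_(n, p)) :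
  U *m v = 0 <-> (pid_mx (\rank U) : 'M[F]_n) *m (row_ebase U *m v) = 0.
Proof.
have UE : U *m v =
    col_ebase U *m ((pid_mx (\rank U) : 'M[F]_(m, n)) *m (row_ebase U *m v)).
  by rewrite -[in LHS](mulmx_ebase U) !mulmxA.
split=> [|h].
  rewrite UE => /(congr1 (mulmx (invmx (col_ebase U)))).
  rewrite mulKmx ?col_ebase_unit// mulmx0.
  move=> /(congr1 (mulmx (pid_mx (\rank U) : 'M[F]_(n, m)))).
  by rewrite mulmxA pid_mx_id ?rank_leq_row// mulmx0.
rewrite UE -(@pid_mx_id F m n n) ?rank_leq_col// -!mulmxA.
by rewrite [pid_mx _ *m (row_ebase U *m v)]h !mulmx0.
Qed.

(** If F sends cosets of ker UA into cosets of ker UB, it induces a Lipschitz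
    map between the quotients. So F stays Lipschitz, uniformly in tau, when both
    sides are stretched by tau transversally to these kernels. The determinants
    of the stretched norms are of order tau^(rank UA) and tau^(rank UB), and
    their comparison for large tau gives the ranks. *)
Lemma mxrank_le_of_lipschitz (R : realType) n mA mB (UA : 'M[R]_(mA, n))
    (UB : 'M[R]_(mB, n)) (F : 'cV[R]_n -> 'cV[R]_n) (K : R) : 0 < K ->
  (forall x x', `|x - x'| <= K * `|F x - F x'|) ->
  (forall x x', `|F x - F x'| <= K * `|x - x'|) ->
  (forall x x', UA *m (x - x') = 0 -> UB *m (F x - F x') = 0) ->
  (\rank UB <= \rank UA)%N.
Proof.
move=> K0 Fexp Flip Fker.
set EA := row_ebase UA; set EB := row_ebase UB.
have EAu : EA \in unitmx by exact: row_ebase_unit.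
have EBu : EB \in unitmx by exact: row_ebase_unit.
set rA := \rank UA in Fker *; set rB := \rank UB in Fker *.
have rAn : (rA <= n)%N by exact: rank_leq_col.
have rBn : (rB <= n)%N by exact: rank_leq_col.
have [c c0 normE] : exists2 c : R, 0 <= c &
    forall v : 'cV[R]_n, `|EB *m v| <= c * `|v|.
  by exists (n%:R * `|EB|) => [|v]; [rewrite mulr_ge0|exact: mulmx_norm_le].
have [c' c'0 normE'] : exists2 c : R, 0 <= c &
    forall v : 'cV[R]_n, `|invmx EA *m v| <= c * `|v|.
  exists (n%:R * `|invmx EA|) => [|v]; first by rewrite mulr_ge0.
  exact: mulmx_norm_le.
pose K' := K + 2 * (c * (K * c')).
have cKc' : 0 <= c * (K * c') by rewrite !mulr_ge0// ltW.
have K'0 : 0 < K' by rewrite ltr_wpDr// mulr_ge0.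
have lip tau x x' : 1 <= tau ->
    `|(dilation n rB tau *m EB) *m (F x - F x')| <=
    K' * `|(dilation n rA tau *m EA) *m (x - x')|.
  move=> tau1; rewrite -!mulmxA; set xi := EA *m (x - x').
  have [le1 le2] := dilation_norm_ge rA xi tau1.
  have dx : x - x' = invmx EA *m xi by rewrite /xi mulKmx.
  (* x2 lies in the coset of x' modulo ker UA, and x - x2 keeps only the
     coordinates of x - x' transversal to that kernel. *)
  pose x2 := x - invmx EA *m ((pid_mx rA : 'M[R]_n) *m xi).
  have x2x' : UA *m (x2 - x') = 0.
    rewrite mulmx_eq0_pid /x2 addrAC mulmxBr mulKVmx// -/xi mulmxBr [X in _ - X]mulmxA.
    by rewrite pid_mx_id// subrr.
  have /mulmx_eq0_pid := Fker _ _ x2x'; rewrite -/EB -/rB => ker2.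
  have pE : (pid_mx rB : 'M[R]_n) *m (EB *m (F x - F x')) =
            (pid_mx rB : 'M[R]_n) *m (EB *m (F x - F x2)).
    rewrite -(subrK (F x2) (F x)) -[_ + _ - F x']addrA mulmxDr mulmxDr ker2.
    by rewrite addr0 subrK.
  have b1 : `|EB *m (F x - F x')| <= c * (K * c') * `|xi|.
    rewrite (le_trans (normE _))// -!mulrA ler_wpM2l//.
    by rewrite (le_trans (Flip _ _))// ler_pM2l// dx.
  have b2 : `|(pid_mx rB : 'M[R]_n) *m (EB *m (F x - F x'))| <=
            c * (K * c') * `|(pid_mx rA : 'M[R]_n) *m xi|.
    rewrite pE (le_trans (pid_mx_norm_le _ _))// (le_trans (normE _))//.
    rewrite -!mulrA ler_wpM2l//.
    by rewrite (le_trans (Flip _ _))// ler_pM2l// /x2 opprB addrC subrK.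
  rewrite mul_dilation (le_trans (ler_normD _ _))// normrZ.
  rewrite ger0_norm ?subr_ge0//.
  set q := `|dilation n rA tau *m xi| in le1 le2 *.
  apply: (@le_trans _ _ (c * (K * c') * (q + q))).
    rewrite mulrDr lerD//; first by rewrite (le_trans b1)// ler_wpM2l.
    apply: (@le_trans _ _ (tau * (c * (K * c') * `|(pid_mx rA : 'M[R]_n) *m xi|))).
      by rewrite ler_pM// ?subr_ge0// gerBl.
    by rewrite mulrCA ler_wpM2l.
  have -> : c * (K * c') * (q + q) = 2 * (c * (K * c')) * q by ring.
  apply: ler_wpM2r; first exact: normr_ge0.
  by rewrite lerDr ltW.
have [C C0 HC] := @det_le_of_lipschitz R n K' K'0.
have detle tau : 1 <= tau ->
    tau ^+ rB * `|\det EB| <= C * (tau ^+ rA * `|\det EA|).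
  move=> tau1; have tau0 : 0 < tau by exact: lt_le_trans tau1.
  have := HC (dilation n rA tau *m EA) (dilation n rB tau *m EB) F.
  rewrite !unitmx_mul EAu EBu !unitmxE !det_dilation// !unitfE.
  rewrite !expf_eq0 !(gt_eqF tau0) !andbF !det_mulmx !det_dilation//.
  rewrite !normrM !(ger0_norm (exprn_ge0 _ (ltW tau0))); apply => // x x'.
    rewrite (le_trans (Fexp _ _))// ler_wpM2r//.
    by rewrite lerDl mulr_ge0.
  exact: lip.
rewrite leqNgt; apply/negP => rAB.
have dB : 0 < `|\det EB| by rewrite normr_gt0 -unitfE -unitmxE.
(* For this tau a single extra factor tau on the side of B beats C. *)
pose tau := C * `|\det EA| / `|\det EB| + 1.
have tau1 : 1 <= tau by rewrite lerDr divr_ge0// mulr_ge0// ltW.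
have tau0 : 0 < tau by exact: lt_le_trans tau1.
have := detle _ tau1; rewrite leNgt => /negP; apply.
have lt_tau : C * `|\det EA| < tau * `|\det EB|.
  by rewrite -ltr_pdivrMr// ltrDl.
apply: (@lt_le_trans _ _ (tau ^+ rA.+1 * `|\det EB|)).
  by rewrite mulrCA exprSr -mulrA ltr_pM2l// exprn_gt0.
by rewrite ler_wpM2r// ler_weXn2l.
Qed.

(** * Jordan bases *)

(** The chain starts at a generator and ends at an eigenvector. The default
    value 0 of nth supplies the zero vector after the last entry. *)
Definition jordan_chain (F : fieldType) (vT : vectType F) (f : 'End(vT))
    (b : F * seq vT) :=
  (0 < size b.2)%N /\
  forall i, (i < size b.2)%N -> f b.2`_i = b.1 *: b.2`_i + b.2`_i.+1.

Definition chain_vectors (F : fieldType) (vT : vectType F)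
  (cs : seq (F * seq vT)) : seq vT := flatten [seq b.2 | b <- cs].

Lemma eigenvector_in_stable (F : numClosedFieldType) (vT : vectType F)
    (f : 'End(vT)) (U : {vspace vT}) : (f @: U <= U)%VS -> U != 0%VS ->
  exists (a : F) (v : vT), [/\ v \in U, v != 0 & f v = a *: v].
Proof.
move=> fU U0; have dU : (0 < \dim U)%N by rewrite lt0n dimv_eq0.
pose e := vbasis U; pose A := \matrix_(i < \dim U, j < \dim U) coord e j (f e`_i).
have [a /eigenvalueP[w wA w0]] := eigenvalue_closed A dU.
have eU := vbasisP U.
have fe (i : 'I_(\dim U)) : f e`_i = \sum_j A i j *: e`_j.
  rewrite [LHS](coord_basis eU).
    by apply: eq_bigr => j _; rewrite mxE.
  by rewrite (subvP fU)// memv_img// vbasis_mem// mem_nth// size_tuple.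
pose v := \sum_i w 0 i *: e`_i.
exists a, v; split.
- by apply: memv_suml => i _; rewrite memvZ// vbasis_mem// mem_nth// size_tuple.
- apply: contra w0 => /eqP v0; apply/eqP/rowP => i; rewrite mxE.
  by have /freeP := basis_free eU; apply.
- rewrite /v linear_sum /= scaler_sumr.
  under eq_bigr do rewrite linearZ /= fe scaler_sumr.
  rewrite exchange_big /=; apply: eq_bigr => j _.
  transitivity ((w *m A) 0 j *: e`_j); last by rewrite wA mxE scalerA.
  by rewrite mxE scaler_suml; apply: eq_bigr => i _; rewrite scalerA.
Qed.

Lemma subseq_free (F : fieldType) (vT : vectType F) (X Y : seq vT) :
  subseq X Y -> free Y -> free X.
Proof.
move=> sXY fY; have /(subseq_uniqP (free_uniq fY)) -> := sXY.
exact: filter_free.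
Qed.

Lemma mem_chain_vectors (F : fieldType) (vT : vectType F)
    (cs : seq (F * seq vT)) b v :
  b \in cs -> v \in b.2 -> v \in chain_vectors cs.
Proof. by move=> bcs vb; apply/flattenP; exists b.2 => //; apply: map_f. Qed.

Lemma chain_vectorsP (F : fieldType) (vT : vectType F)
    (cs : seq (F * seq vT)) v :
  reflect (exists2 b, b \in cs & v \in b.2) (v \in chain_vectors cs).
Proof.
apply: (iffP flattenP) => [[_ /mapP[b bcs ->] vb]|[b bcs vb]]; first by exists b.
by exists b.2 => //; apply: map_f.
Qed.

(** Filippov's induction. For an eigenvalue a of f on U put g = f - a; the image
    W of g is smaller and has a Jordan basis. Each chain for a is prolonged by a
    g-preimage of its first vector, and a basis of a complement of ker g \cap W
    in ker g is added as chains of length one. The new vectors span: the image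
    of their span under g contains W, and their span contains ker g. They are
    few enough because the last vectors of the chains for a are independent in
    ker g \cap W. *)
Lemma jordan_basis (F : numClosedFieldType) (vT : vectType F)
    (f : 'End(vT)) (U : {vspace vT}) : (f @: U <= U)%VS ->
  exists cs : seq (F * seq vT),
    (forall b, b \in cs -> jordan_chain f b) /\ basis_of U (chain_vectors cs).
Proof.
have [d] := ubnP (\dim U); elim: d U => // d IHd U; rewrite ltnS => dUd fU.
have [->|U0] := eqVneq U 0%VS; first by exists [::]; split=> //; exact: nil_basis.
have [a [v [vU v0 fv]]] := eigenvector_in_stable fU U0.
pose g : 'End(vT) := f - a *: \1%VF.
have gE x : g x = f x - a *: x.
  by rewrite add_lfunE opp_lfunE scale_lfunE id_lfunE.
have fE x : f x = a *: x + g x by rewrite gE addrC subrK.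
pose W := (g @: U)%VS.
have gU x : x \in U -> g x \in U.
  by move=> xU; rewrite gE rpredB ?rpredZ// (subvP fU)// memv_img.
have WU : (W <= U)%VS by apply/subvP => _ /memv_imgP[x xU ->]; exact: gU.
have fW : (f @: W <= W)%VS.
  apply/subvP => _ /memv_imgP[_ /memv_imgP[x xU ->] ->].
  have -> : f (g x) = g (f x) by rewrite !gE linearB linearZ /=.
  by rewrite memv_img// (subvP fU)// memv_img.
have dimU := limg_ker_dim g U; rewrite -/W in dimU.
pose Ker := (U :&: lker g)%VS.
have dW : (\dim W < d)%N.
  apply: leq_trans dUd; rewrite -dimU -/Ker -[X in (X < _)%N]add0n ltn_add2r.
  rewrite lt0n dimv_eq0; apply: contra v0 => /eqP K0.
  by rewrite -memv0 -K0 memv_cap vU memv_ker gE fv subrr eqxx.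
have [cs [csP csW]] := IHd _ dW fW.
have memW b x : b \in cs -> x \in b.2 -> x \in W.
  by move=> bcs xb; apply: (basis_mem csW); apply: mem_chain_vectors xb.
pose pre w := xget 0 [set u | u \in U /\ g u = w]%classic.
have preP w : w \in W -> pre w \in U /\ g (pre w) = w.
  move=> /memv_imgP[u uU ->].
  suff : [set u' | u' \in U /\ g u' = g u]%classic (pre (g u)) by [].
  by apply: xgetPex; exists u.
pose ext (b : F * seq vT) :=
  if b.1 == a then (a, pre (head 0 b.2) :: b.2) else b.
have subext b : {subset b.2 <= (ext b).2}.
  by move=> x xb; rewrite /ext; case: ifP => //= _; rewrite inE xb orbT.
have headW b : b \in cs -> head 0 b.2 \in W.
  move=> bcs; have [sb _] := csP _ bcs.
  by apply: (memW b) => //; case: (b.2) sb => //= x s _; rewrite inE eqxx.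
pose Z := vbasis (Ker :\: W)%VS.
pose cs' := [seq ext b | b <- cs] ++ [seq (a, [:: w]) | w <- Z].
have ZKer w : w \in Z -> w \in U /\ g w = 0.
  move=> /vbasis_mem /(subvP (diffvSl _ _)); rewrite memv_cap memv_ker.
  by move=> /andP[wU /eqP].
have extcs' b : b \in cs -> ext b \in cs'.
  by move=> bcs; rewrite mem_cat map_f.
exists cs'; split.
  move=> b; rewrite mem_cat => /orP[/mapP[{}b bcs ->]|/mapP[w wZ ->]].
    have [sb chb] := csP _ bcs; rewrite /ext; case: eqP => [ba|//].
    split=> //= -[_|i]/=.
      have [_ gp] := preP _ (headW _ bcs).
      by rewrite fE gp -nth0.
    by rewrite ltnS => ib; rewrite chb// ba.
  split=> // -[|//] _ /=.
  by have [_ gw] := ZKer _ wZ; rewrite fE gw.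
pose S := <<chain_vectors cs'>>%VS.
have memS b x : b \in cs' -> x \in b.2 -> x \in S.
  by move=> bcs xb; apply: memv_span; apply: mem_chain_vectors xb.
have SU : (S <= U)%VS.
  apply/span_subvP => x /chain_vectorsP[b]; rewrite mem_cat => /orP[].
    move=> /mapP[{}b bcs ->]; rewrite /ext; case: ifP => /= _.
      rewrite inE => /orP[/eqP->|xb]; first by have [] := preP _ (headW _ bcs).
      by rewrite (subvP WU)// (memW b).
    by move=> xb; rewrite (subvP WU)// (memW b).
  move=> /mapP[w wZ ->] /=; rewrite inE => /eqP ->.
  by have [] := ZKer _ wZ.
have WS : (W <= S)%VS.
  rewrite -(span_basis csW); apply/span_subvP => x /chain_vectorsP[b bcs xb].
  by apply: (memS (ext b)); [exact: extcs'|exact: subext].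
have WgS : (W <= g @: S)%VS.
  rewrite -(span_basis csW); apply/span_subvP => _ /chain_vectorsP[b bcs /(nthP 0)[i ib <-]].
  have [sb chb] := csP _ bcs; have [ba|ba] := eqVneq b.1 a.
    have extE : (ext b).2 = pre (head 0 b.2) :: b.2 by rewrite /ext ba eqxx.
    case: i ib => [|i] ib.
      have [_ gp] := preP _ (headW _ bcs); rewrite nth0 -gp memv_img//.
      by apply: (memS (ext b)); [exact: extcs'|rewrite extE inE eqxx].
    have -> : b.2`_i.+1 = g b.2`_i.
      by rewrite gE chb ?(ltnW ib)// ba addrC addKr.
    rewrite memv_img//; apply: (memS (ext b)); first exact: extcs'.
    by apply: subext; rewrite mem_nth// ltnW.
  have [k] := ubnP (size b.2 - i); elim: k i ib => // k IHk i ib.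
  rewrite ltnS => ki.
  have giE : g b.2`_i = (b.1 - a) *: b.2`_i + b.2`_i.+1.
    by rewrite gE chb// scalerBl addrAC.
  have -> : b.2`_i = (b.1 - a)^-1 *: (g b.2`_i - b.2`_i.+1).
    by rewrite giE addrK scalerA mulVf ?scale1r// subr_eq0.
  rewrite rpredZ// rpredB//.
    by rewrite memv_img// (subvP WS)// (memW b)// mem_nth.
  have [ib1|ib1] := ltnP i.+1 (size b.2).
    by apply: IHk => //; rewrite subnS; case: (size b.2 - i)%N (subn_gt0 i (size b.2)) ki => [|m] //; rewrite ib.
  by rewrite nth_default// mem0v.
have KerS : (Ker <= S)%VS.
  rewrite -(addv_diff_cap Ker W) subv_add; apply/andP; split.
    rewrite -(span_basis (vbasisP (Ker :\: W)%VS)); apply/span_subvP => w wZ.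
    apply: (memS (a, [:: w])); last by rewrite inE.
    by rewrite mem_cat; apply/orP; right; apply/mapP; exists w.
  by apply: subv_trans (capvSr _ _) WS.
rewrite basisEdim; apply/andP; split.
  apply/subvP => x xU.
  have /(subvP WgS)/memv_imgP[s sS gxs] : g x \in W by rewrite memv_img.
  rewrite -(subrK s x) rpredD//; apply: (subvP KerS).
  by rewrite memv_cap rpredB ?(subvP SU s)//= memv_ker linearB /= gxs subrr eqxx.
pose bots := [seq last 0 b.2 | b <- cs & b.1 == a].
have bots_sub : subseq bots (chain_vectors cs).
  rewrite /bots /chain_vectors; elim: (cs) csP => //= b s IHs sP.
  have [sb _] := sP b (mem_head _ _).
  have {}IHs : subseq [seq last 0 b.2 | b <- s & b.1 == a]
                      (flatten [seq b.2 | b <- s]).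
    by apply: IHs => b' b's; apply: sP; rewrite inE b's orbT.
  case: ifP => _ /=; last first.
    by apply: subseq_trans IHs _; exact: suffix_subseq.
  rewrite -cat1s cat_subseq// sub1seq.
  by case: (b.2) sb => //= x t _; exact: mem_last.
have botsKW : {subset bots <= (Ker :&: W)%VS}.
  move=> x /mapP[b]; rewrite mem_filter => /andP[/eqP ba bcs] ->.
  have [sb chb] := csP _ bcs.
  have lb : last 0 b.2 = b.2`_(size b.2).-1 by rewrite nth_last.
  have lW : last 0 b.2 \in W.
    by rewrite lb (memW b)// mem_nth// prednK.
  rewrite !memv_cap lW (subvP WU)//= andbT memv_ker gE lb chb ?prednK//.
  by rewrite [b.2`_(size b.2)]nth_default// addr0 ba subrr eqxx.
have size_bots : (size bots <= \dim (Ker :&: W))%N.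
  have /eqP <- : free bots := subseq_free bots_sub (basis_free csW).
  by apply: dimvS; apply/span_subvP.
have sizecs : size (chain_vectors cs) = \dim W.
  by have /andP[/eqP <- /eqP ->] := csW.
rewrite -dimU -/Ker -(dimv_cap_compl Ker W) -sizecs.
rewrite /chain_vectors map_cat flatten_cat size_cat -!map_comp.
have -> : size (flatten [seq (snd \o (fun w => (a, [:: w]))) w | w <- Z]) =
    \dim (Ker :\: W).
  rewrite size_flatten /shape -map_comp sumnE big_map.
  by rewrite (eq_bigr (fun=> 1%N))// sum1_size size_tuple.
have -> : size (flatten [seq (snd \o ext) b | b <- cs]) =
    (size bots + size (flatten [seq b.2 | b <- cs]))%N.
  rewrite /bots size_map; elim: (cs) => //= b s IHs.
  rewrite !size_cat {}IHs /= /ext; case: ifP => _ /=; by rewrite ?addSn addnCA.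
by rewrite addnAC leq_add2r addnC [in leqRHS]addnC leq_add2l.
Qed.

(** * Growth of powers along a Jordan chain *)

Lemma bin_le_expS j c : ('C(j, c) <= j.+1 ^ c)%N.
Proof.
elim: c => [|c IHc]; first by rewrite bin0.
have /leq_trans : ('C(j, c.+1) <= c.+1 * 'C(j, c.+1))%N by rewrite leq_pmull.
apply; rewrite mul_bin_left expnS leq_mul// (leq_trans (leq_subr _ _))//.
Qed.

Lemma expS_le_bin j c : (j.+1 ^ c <= c`! * 'C(j + c, c))%N.
Proof.
elim: c => [|c IHc]; first by rewrite bin0.
rewrite addnS factS (mulnC c.+1) -mulnA -mul_bin_diag /= mulnCA expnS.
by rewrite leq_mul// ltnS leq_addr.
Qed.

(** Induction on k, spending a square root of theta at each step; the linear
    factor is absorbed by Bernoulli's inequality. *)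
Lemma poly_le_geometric (R : realType) (k : nat) (theta : R) : 1 < theta ->
  exists2 c, 0 < c & forall j : nat, j.+1%:R ^+ k <= c * theta ^+ j.
Proof.
elim: k theta => [|k IHk] theta th1.
  by exists 1 => // j; rewrite mul1r expr0 exprn_ege1// ltW.
pose q := Num.sqrt theta.
have q1 : 1 < q by rewrite -[1]sqrtr1 ltr_sqrt// (lt_trans _ th1).
have [c c0 cP] := IHk q q1; set h := q - 1.
have h0 : 0 < h by rewrite subr_gt0.
have bern (j : nat) : 1 + j%:R * h <= q ^+ j.
  elim: j => [|j IHj]; first by rewrite mul0r addr0.
  rewrite exprS; apply: (@le_trans _ _ (q * (1 + j%:R * h))).
    have -> : q = 1 + h by rewrite /h; ring.
    have : 0 <= j%:R * h * h by rewrite !mulr_ge0// ltW.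
    by rewrite -natr1; lra.
  by rewrite ler_wpM2l// (le_trans _ (ltW q1)).
exists (c * (1 + h^-1)) => [|j].
  by rewrite mulr_gt0// ltr_pwDl// ltW// invr_gt0.
have qq : theta = q * q by rewrite -expr2 sqr_sqrtr// (le_trans _ (ltW th1)).
rewrite exprS qq exprMn mulrC.
have -> : c * (1 + h^-1) * (q ^+ j * q ^+ j) =
          (c * q ^+ j) * ((1 + h^-1) * q ^+ j) by ring.
rewrite ler_pM// ?exprn_ge0//.
apply: (@le_trans _ _ ((1 + h^-1) * (1 + j%:R * h))); last first.
  by rewrite ler_pM2l// ltr_pwDl// ltW// invr_gt0.
have -> : (1 + h^-1) * (1 + j%:R * h) = j.+1%:R + (h^-1 + j%:R * h).
  by rewrite -natr1; field; rewrite gt_eqF.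
by rewrite lerDl addr_ge0// ?mulr_ge0// ltW// invr_gt0.
Qed.

(** The binomial expansion of (a + g)^j on a chain, where g shifts the chain. *)
Lemma chain_power (F : fieldType) n (M : 'M[F]_n) (a : F) (s : seq 'rV[F]_n) :
  a != 0 ->
  (forall i, (i < size s)%N -> s`_i *m M = a *: s`_i + s`_i.+1) ->
  forall j b, s`_b *m M ^+ j =
    \sum_(c < (size s).+1) ('C(j, c)%:R * a ^+ j / a ^+ c) *: s`_(b + c).
Proof.
move=> a0 sP; have {}sP i : s`_i *m M = a *: s`_i + s`_i.+1.
  have [/sP//|sz] := ltnP i (size s).
  by rewrite !nth_default// ?mul0mx ?scaler0 ?addr0// (leq_trans sz).
elim=> [|j IHj] b.
  rewrite expr0 mulmx1 big_ord_recl /= bin0 expr0 divr1 mulr1 scale1r addn0.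
  by rewrite big1 ?addr0// => i _; rewrite bin0n /= !mul0r scale0r.
rewrite exprS -mulmxE mulmxA sP mulmxDl -scalemxAl !IHj.
rewrite [X in _ + X]big_ord_recr /= (@nth_default _ 0 s (b.+1 + size s)) ?leq_addl//.
rewrite scaler0 addr0.
rewrite big_ord_recl [RHS]big_ord_recl /= scalerDr -addrA; congr (_ + _).
  by rewrite !bin0 scalerA exprS; congr (_ *: _); ring.
rewrite scaler_sumr -big_split /=; apply: eq_bigr => i _.
rewrite scalerA /bump /= add1n addSnnS -scalerDl binS natrD !exprS.
by congr (_ *: _); field; rewrite a0 expf_neq0.
Qed.

(** z is O(lam^j (j+1)^(k-1)). The factor j+1 stands on the left so that k = 0
    is allowed: this threshold rules out all eigenvalues of modulus lam. *)
Definition dominated (R : realType) (lam : R) (k : nat) (z : nat -> R[i]) :=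
  exists c : R, forall j,
    j.+1%:R * normc (z j) <= c * (lam ^+ j * j.+1%:R ^+ k).

Lemma dominated0 (R : realType) (lam : R) k : dominated lam k (fun=> 0).
Proof. by exists 0 => j; rewrite normc0 mulr0 mul0r. Qed.

Lemma dominatedD (R : realType) (lam : R) k y z :
  dominated lam k y -> dominated lam k z -> dominated lam k (fun j => y j + z j).
Proof.
move=> [c cP] [d dP]; exists (c + d) => j; rewrite mulrDl.
by apply: le_trans (lerD (cP j) (dP j)); rewrite -mulrDr ler_wpM2l// le_normcD.
Qed.

Lemma dominatedZ (R : realType) (lam : R) k a z :
  dominated lam k z -> dominated lam k (fun j => a * z j).
Proof.
move=> [c cP]; exists (normc a * c) => j.
have normc_ge0 : 0 <= normc a by case: (a) => x y; exact: sqrtr_ge0.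
by rewrite normcM mulrCA -mulrA ler_wpM2l.
Qed.

Lemma dominated_sum (R : realType) (lam : R) k (I : Type) (r : seq I)
    (P : pred I) (z : I -> nat -> R[i]) :
  (forall i, P i -> dominated lam k (z i)) ->
  dominated lam k (fun j => \sum_(i <- r | P i) z i j).
Proof.
move=> zP; elim: r => [|i r IHr].
  have [c cP] := dominated0 lam k; exists c => j; rewrite big_nil; exact: cP.
case: (boolP (P i)) => Pi.
  have [c cP] := dominatedD (zP i Pi) IHr; exists c => j.
  by rewrite big_cons Pi; exact: cP.
have [c cP] := IHr; exists c => j; rewrite big_cons (negPf Pi); exact: cP.
Qed.

Lemma normc_ge0 (R : rcfType) (z : R[i]) : 0 <= normc z.
Proof. by case: z => x y; exact: sqrtr_ge0. Qed.

Lemma normc_gt0 (R : rcfType) (z : R[i]) : (0 < normc z) = (z != 0).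
Proof.
rewrite lt0r normc_ge0 andbT; congr (~~ _); apply/eqP/eqP => [|->].
  exact: eq0_normc.
exact: normc0.
Qed.

Lemma normcX (R : rcfType) (z : R[i]) j : normc (z ^+ j) = normc z ^+ j.
Proof. by elim: j => [|j IHj]; rewrite ?normc1// !exprS normcM IHj. Qed.

Lemma normc_nat (R : rcfType) (j : nat) : normc (j%:R : R[i]) = j%:R.
Proof. by rewrite normcMn normc1. Qed.

Lemma dominated_ge0 (R : realType) (lam : R) k z : 0 < lam ->
  dominated lam k z ->
  exists2 c : R, 0 <= c &
  forall j, j.+1%:R * normc (z j) <= c * (lam ^+ j * j.+1%:R ^+ k).
Proof.
move=> lam0 [c cP]; exists `|c| => // j; apply: le_trans (cP j) _.
by rewrite ler_wpM2r ?ler_norm// mulr_ge0// exprn_ge0// ltW.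
Qed.

Lemma dominated_leq (R : realType) (lam : R) k m z : 0 < lam -> (k <= m)%N ->
  dominated lam k z -> dominated lam m z.
Proof.
move=> lam0 km /(dominated_ge0 lam0)[c c0 cP]; exists c => j.
apply: le_trans (cP j) _; rewrite ler_wpM2l// ler_wpM2l ?exprn_ge0 ?(ltW lam0)//.
by rewrite ler_weXn2l// ler1n.
Qed.

Lemma le0_of_bounded_multiples (R : realType) (c y : R) :
  (forall j, j.+1%:R * y <= c) -> y <= 0.
Proof.
move=> H; rewrite leNgt; apply/negP => y0.
have := H (Num.truncn (c / y)); rewrite leNgt => /negP; apply.
by rewrite -ltr_pdivrMr// truncnS_gt.
Qed.

(** The term of index c in the j-th power along a chain has exact order
    |a|^j j^c. *)
Lemma dominated_term (R : realType) (lam : R) k (a y : R[i]) c :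
  0 < lam -> a != 0 -> normc a < lam \/ normc a = lam /\ (c < k)%N ->
  dominated lam k (fun j => 'C(j, c)%:R * a ^+ j / a ^+ c * y).
Proof.
move=> lam0 a0 H; have na0 : 0 < normc a by rewrite normc_gt0.
suff [d d0 dP] : exists2 d : R, 0 <= d &
    forall j, j.+1%:R ^+ c.+1 * normc a ^+ j <= d * (lam ^+ j * j.+1%:R ^+ k).
  pose e := normc y / normc a ^+ c.
  have e0 : 0 <= e by rewrite divr_ge0 ?normc_ge0 ?exprn_ge0 ?normc_ge0.
  exists (e * d) => j; rewrite !normcM normcV !normcX normc_nat.
  have -> : j.+1%:R * ('C(j, c)%:R * normc a ^+ j / normc a ^+ c * normc y) =
    e * (j.+1%:R * 'C(j, c)%:R * normc a ^+ j) by rewrite /e; ring.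
  rewrite -[leRHS]mulrA ler_wpM2l//; apply: le_trans (dP j).
  rewrite ler_wpM2r ?exprn_ge0 ?(ltW na0)// exprS ler_wpM2l//.
  by rewrite -natrX ler_nat bin_le_expS.
case: H => [alam|[-> ck]]; last first.
  exists 1 => // j; rewrite mul1r mulrC ler_wpM2l ?exprn_ge0 ?(ltW lam0)//.
  by rewrite ler_weXn2l// ler1n.
have th1 : 1 < lam / normc a by rewrite ltr_pdivlMr// mul1r.
have [d d0 dP] := poly_le_geometric c.+1 th1; exists d => [|j]; first exact: ltW.
rewrite -ler_pdivlMr ?exprn_gt0//; apply: le_trans (dP j) _.
rewrite -mulrA ler_pM2l// expr_div_n ler_wpM2r ?invr_ge0 ?exprn_ge0 ?(ltW na0)//.
by rewrite ler_peMr ?exprn_ge0 ?(ltW lam0)// exprn_ege1// ler1n.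
Qed.

Lemma dominated_exp_eq0 (R : realType) (lam : R) k (a y : R[i]) :
  0 < lam -> lam < normc a -> dominated lam k (fun j => a ^+ j * y) -> y = 0.
Proof.
move=> lam0 lama /(dominated_ge0 lam0)[c c0 cP].
have na0 : 0 < normc a by exact: lt_trans lama.
have th1 : 1 < normc a / lam by rewrite ltr_pdivlMr// mul1r.
have [d d0 dP] := poly_le_geometric k th1.
apply: eq0_normc; apply/eqP; rewrite eq_le normc_ge0 andbT.
apply: (@le0_of_bounded_multiples _ (c * d)) => j.
have := cP j; rewrite normcM normcX => cPj.
rewrite -(@ler_pM2r _ (normc a ^+ j)) ?exprn_gt0//.
rewrite -mulrA [normc y * _]mulrC; apply: le_trans cPj _.
rewrite -mulrA ler_wpM2l//.
have -> : d * normc a ^+ j = lam ^+ j * (d * (normc a / lam) ^+ j).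
  by rewrite expr_div_n; field; rewrite expf_neq0// gt_eqF.
by rewrite ler_wpM2l// exprn_ge0// ltW.
Qed.

(** The summands with c < m are of lower order, so the top one would be
    dominated by (j+1)^(m-1) although 'C(j, m) is of order j^m. *)
Lemma dominated_binomial_eq0 (R : realType) (lam : R) k m (a : R[i])
    (y : nat -> R[i]) : 0 < lam -> normc a = lam -> (k <= m)%N ->
  dominated lam k
    (fun j => \sum_(c < m.+1) 'C(j, c)%:R * a ^+ j / a ^+ c * y c) -> y m = 0.
Proof.
move=> lam0 alam km /(dominated_leq lam0 km) dom.
have a0 : a != 0 by rewrite -normc_gt0 alam.
have domN : dominated lam m
    (fun j => \sum_(c < m) - (1) * ('C(j, c)%:R * a ^+ j / a ^+ c * y c)).
  apply: dominated_sum => c _; apply: dominatedZ; apply: dominated_term => //.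
  by right.
have [c c0 cP] := dominated_ge0 lam0 (dominatedD dom domN).
have [na0 nam0] : 0 < normc a /\ 0 < normc a ^+ m.
  by rewrite exprn_gt0 ?normc_gt0.
pose Y := normc (y m) / normc a ^+ m.
have Yb j : j.+1%:R * 'C(j, m)%:R * Y <= c * j.+1%:R ^+ m.
  have := cP j; rewrite big_ord_recr /= addrAC -big_split /=.
  rewrite big1 ?add0r => [|i _]; last by rewrite mulN1r subrr.
  rewrite !normcM normcV !normcX normc_nat -alam => h.
  rewrite -(@ler_pM2r _ (normc a ^+ j)) ?exprn_gt0//.
  rewrite (_ : _ * _ * Y * _ = j.+1%:R *
    ('C(j, m)%:R * normc a ^+ j / normc a ^+ m * normc (y m))); last first.
    by rewrite /Y; ring.
  by apply: le_trans h _; rewrite -mulrA [X in _ <= _ * X]mulrC.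
have Y0 : 0 <= Y by rewrite divr_ge0 ?normc_ge0// ltW.
have : Y <= 0.
  apply: (@le0_of_bounded_multiples _ (c * (m.+1%:R ^+ m * m`!%:R))) => j.
  have Cjm0 : 0 < ('C(j + m, m))%:R :> R by rewrite ltr0n bin_gt0 leq_addl.
  rewrite -(@ler_pM2r _ 'C(j + m, m)%:R)// mulrAC.
  apply: (@le_trans _ _ ((j + m).+1%:R * 'C(j + m, m)%:R * Y)).
    by rewrite ler_wpM2r// ler_wpM2r ?(ltW Cjm0)// ler_nat ltnS leq_addr.
  apply: le_trans (Yb _) _; rewrite -mulrA ler_wpM2l// -!natrX -!natrM ler_nat.
  apply: (@leq_trans ((m.+1 * j.+1) ^ m)%N).
    have [->//|m0] := posnP m.
    by rewrite leq_exp2r// mulSn mulnS addSn ltnS leq_add2l leq_addr.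
  by rewrite expnMn -mulnA leq_mul// expS_le_bin.
rewrite /Y pmulr_lle0 ?invr_gt0// => ym0.
by apply: eq0_normc; apply/eqP; rewrite eq_le ym0 normc_ge0.
Qed.

(** The vectors of a chain whose pairing with v obstructs the growth bound of
    threshold (lam, k). *)
Definition chain_tail (R : realType) n (lam : R) (k : nat)
    (b : R[i] * seq 'rV[R[i]]_n) : seq 'rV[R[i]]_n :=
  if lam < normc b.1 then b.2
  else if lam == normc b.1 then drop k b.2 else [::].

Lemma mx11_eq0 (F : nzRingType) (x : 'M[F]_1) : x 0 0 = 0 -> x = 0.
Proof. by move=> x0; apply/matrixP => i j; rewrite !ord1 x0 mxE. Qed.

Definition row_action (F : fieldType) n (M : 'M[F]_n) : 'End('rV[F]_n) :=
  linfun (mulmxr M).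

Lemma row_actionE (F : fieldType) n (M : 'M[F]_n) (p : 'rV[F]_n) :
  row_action M p = p *m M.
Proof. by rewrite lfunE. Qed.

Lemma chain_eigenvalue_neq0 (F : fieldType) n (M : 'M[F]_n)
    (cs : seq (F * seq 'rV[F]_n)) b : M \in unitmx ->
  (forall b, b \in cs -> jordan_chain (row_action M) b) ->
  free (chain_vectors cs) -> b \in cs -> b.1 != 0.
Proof.
move=> Mu csP fcs bcs; have [sb chb] := csP _ bcs.
apply/eqP => a0; have ls : ((size b.2).-1 < size b.2)%N by rewrite prednK.
have := chb _ ls; rewrite row_actionE a0 scale0r add0r prednK//.
rewrite [b.2`_(size b.2)]nth_default// => /(congr1 (mulmx^~ (invmx M))).
rewrite mulmxK// mul0mx => w0; have := free_not0 fcs.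
move=> /(_ b.2`_(size b.2).-1); rewrite w0 eqxx => /(_ _)/negP; apply=> //.
by rewrite -w0; apply: (mem_chain_vectors bcs); rewrite mem_nth.
Qed.

Lemma chain_coord_power (F : fieldType) n (M : 'M[F]_n) (v : 'cV[F]_n) b :
  b.1 != 0 -> jordan_chain (row_action M) b -> forall j i,
  (b.2`_i *m M ^+ j *m v) 0 0 =
  \sum_(c < (size b.2).+1)
    'C(j, c)%:R * b.1 ^+ j / b.1 ^+ c * (b.2`_(i + c) *m v) 0 0.
Proof.
move=> a0 [_ chb] j i; have {}chb l : (l < size b.2)%N ->
  b.2`_l *m M = b.1 *: b.2`_l + b.2`_l.+1 by move=> /chb; rewrite row_actionE.
rewrite (chain_power a0 chb) mulmx_suml summxE; apply: eq_bigr => c _.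
by rewrite -scalemxAl mxE.
Qed.

(** The coordinate of highest index i of v along a chain is the leading
    coefficient of a polynomial of degree i in j times a^j. If a has modulus
    > lam, the pairing with the chain vector i itself is a pure exponential; for
    modulus lam, the first vector of the chain sees the full degree i. Both
    cases descend from the end of the chain. Conversely, if the tail pairings
    vanish then each remaining term has the required order. *)
Lemma dominated_iff_tail (R : realType) n (M : 'M[R[i]]_n)
    (cs : seq (R[i] * seq 'rV[R[i]]_n)) (lam : R) (k : nat) (v : 'cV[R[i]]_n) :
  M \in unitmx -> (forall b, b \in cs -> jordan_chain (row_action M) b) ->
  basis_of fullv (chain_vectors cs) -> 0 < lam ->
  (forall p : 'rV_n, dominated lam k (fun j => (p *m M ^+ j *m v) 0 0)) <->
  (forall x, x \in flatten [seq chain_tail lam k b | b <- cs] -> x *m v = 0).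
Proof.
move=> Mu csP csb lam0.
have a0 b : b \in cs -> b.1 != 0.
  exact: (chain_eigenvalue_neq0 Mu csP (basis_free csb)).
split=> [dom x /flattenP[_ /mapP[b bcs ->] xb]|tail0 p].
  have nth0v i : (size b.2 <= i)%N -> (b.2`_i *m v) 0 0 = 0.
    by move=> si; rewrite nth_default// mul0mx mxE.
  have cp := chain_coord_power v (a0 _ bcs) (csP _ bcs).
  apply: mx11_eq0; move: xb; rewrite /chain_tail; case: ifPn => [lama|_].
    move=> /(nthP 0)[i _ <-].
    have [d] := ubnP (size b.2 - i); elim: d i => // d IHd i; rewrite ltnS => di.
    have [si|si] := leqP (size b.2) i; first exact: nth0v.
    apply: (@dominated_exp_eq0 _ _ k _ _ lam0 lama); have [c cP] := dom b.2`_i.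
    exists c => j; have := cP j; rewrite cp big_ord_recl /= bin0 mul1r divr1.
    rewrite addn0 big1 ?addr0// => l _; rewrite IHd ?mulr0//.
    rewrite /bump /= add1n; apply: leq_trans di.
    by rewrite ltn_sub2l// addnS ltnS leq_addr.
  case: eqP => [lama|_]; last by rewrite in_nil.
  move=> /(nthP 0)[i ik <-]; rewrite size_drop in ik; rewrite nth_drop.
  rewrite ltn_subRL in ik.
  have : (k <= k + i)%N by rewrite leq_addr.
  move: (k + i)%N ik => {}i _.
  have [d] := ubnP (size b.2 - i); elim: d i => // d IHd i; rewrite ltnS => di ki.
  have [si|si] := leqP (size b.2) i; first exact: nth0v.
  apply: (@dominated_binomial_eq0 _ lam k i b.1 (fun c => (b.2`_c *m v) 0 0)) => //.
  have [c cP] := dom b.2`_0; exists c => j; have := cP j; rewrite cp.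
  rewrite [X in _ -> _ * normc X <= _](big_ord_widen (size b.2).+1 (fun c =>
     'C(j, c)%:R * b.1 ^+ j / b.1 ^+ c * (b.2`_c *m v) 0 0)) ?ltnS 1?ltnW//.
  rewrite [X in _ -> _ * normc X <= _]big_mkcond /=; congr (_ * normc _ <= _).
  apply: eq_bigr => l _; rewrite add0n; case: ifPn => //; rewrite -leqNgt => il.
  rewrite IHd ?mulr0//; last by rewrite (leq_trans ki)// ltnW.
  by apply: leq_trans di; rewrite ltn_sub2l.
have domb b i : b \in cs -> dominated lam k (fun j => (b.2`_i *m M ^+ j *m v) 0 0).
  move=> bcs.
  suff [c cP] : dominated lam k (fun j => \sum_(c < (size b.2).+1)
      'C(j, c)%:R * b.1 ^+ j / b.1 ^+ c * (b.2`_(i + c) *m v) 0 0).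
    by exists c => j; rewrite (chain_coord_power v (a0 _ bcs) (csP _ bcs)).
  apply: dominated_sum => c _.
  have [y0|y0] := eqVneq ((b.2`_(i + c) *m v) 0 0) 0.
    rewrite y0; have [d dP] := dominated0 lam k; exists d => j.
    by rewrite mulr0; exact: dP.
  have ib : (i + c < size b.2)%N.
    by rewrite ltnNge; apply: contraNN y0 => si; rewrite nth_default// mul0mx mxE.
  have ytail : b.2`_(i + c) \notin chain_tail lam k b.
    apply: contraNN y0 => yt; rewrite tail0 ?mxE//.
    by apply/flattenP; exists (chain_tail lam k b) => //; apply: map_f.
  apply: dominated_term => //; first exact: a0.
  move: ytail; rewrite /chain_tail; case: ltgtP => [_ nt|lama _|lama nt].
  - by rewrite mem_nth in nt.
  - by left.
  - right; split=> //; rewrite ltnNge; apply: contraNN nt => kc.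
    rewrite -(subnKC (leq_trans kc (leq_addl i c))) -nth_drop mem_nth//.
    by rewrite size_drop ltn_sub2r// (leq_ltn_trans _ ib)// (leq_trans kc)// leq_addl.
have : p \in <<chain_vectors cs>>%VS by rewrite (span_basis csb) memvf.
rewrite -[chain_vectors cs]in_tupleE => /coord_span ->.
set X := in_tuple _.
suff [c cP] : dominated lam k (fun j => \sum_(l < size (chain_vectors cs))
    coord X l p * (X`_l *m M ^+ j *m v) 0 0).
  exists c => j; have := cP j; congr (_ * normc _ <= _).
  rewrite !mulmx_suml summxE; apply: eq_bigr => l _.
  by rewrite -!scalemxAl [RHS]mxE.
apply: dominated_sum => l _; apply: dominatedZ.
have : X`_l \in chain_vectors cs by rewrite mem_nth.
by move=> /chain_vectorsP[b bcs /(nthP 0)[i _ <-]]; exact: domb.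
Qed.

(** * Real subspaces of prescribed growth *)

(** The length of chain_tail, read off from the modulus and size of the block. *)
Definition tail_size (R : realType) (lam : R) (k : nat) (b : R * nat) : nat :=
  if lam < b.1 then b.2 else if lam == b.1 then (b.2 - k)%N else 0%N.

Definition growth_le (R : realType) n (A : 'M[R]_n) (lam : R) (k : nat)
    (v : 'cV[R]_n) :=
  exists c : R, forall j,
    j.+1%:R * `|A ^+ j *m v| <= c * (lam ^+ j * j.+1%:R ^+ k).

Lemma normc_conjc (R : rcfType) (z : R[i]) : normc (conjc z) = normc z.
Proof. by case: z => x y /=; rewrite sqrrN. Qed.

Lemma normc_real (R : rcfType) (x : R) : normc (real_complex R x) = `|x|.
Proof. by rewrite /normc /= expr0n addr0 sqrtr_sqr. Qed.

Lemma map_mxX (F E : fieldType) (f : {rmorphism F -> E}) n (A : 'M[F]_n) j :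
  map_mx f (A ^+ j) = map_mx f A ^+ j.
Proof.
elim: j => [|j IHj]; first by rewrite !expr0 map_mx1.
by rewrite !exprS -!mulmxE map_mxM IHj.
Qed.

Lemma dominated_real (R : realType) n (A : 'M[R]_n) (lam : R) k (v : 'cV[R]_n) :
  0 < lam ->
  (forall p : 'rV_n, dominated lam k
     (fun j => (p *m map_mx (real_complex R) A ^+ j *m map_mx (real_complex R) v) 0 0))
  <-> growth_le A lam k v.
Proof.
move=> lam0.
have E j (p : 'rV[R[i]]_n) :
    (p *m map_mx (real_complex R) A ^+ j *m map_mx (real_complex R) v) 0 0 =
    \sum_l p 0 l * real_complex R ((A ^+ j *m v) l 0).
  by rewrite -mulmxA -map_mxX -map_mxM mxE; apply: eq_bigr => l _; rewrite mxE.
split=> [dom|[c cP] p].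
  have /fin_all_exists2[c c0 cP] : forall l, exists2 c : R, 0 <= c & forall j,
      j.+1%:R * `|(A ^+ j *m v) l 0| <= c * (lam ^+ j * j.+1%:R ^+ k).
    move=> l; have [c c0 cP] := dominated_ge0 lam0 (dom (delta_mx 0 l)).
    exists c => // j; have := cP j; rewrite E (bigD1 l)//= big1 => [|i il].
      by rewrite addr0 mxE !eqxx mul1r normc_real.
    by rewrite mxE eqxx /= (negPf il) mul0r.
  exists (\sum_l c l) => j; rewrite mulrC -ler_pdivlMr ?ltr0n//.
  have pos0 : 0 <= lam ^+ j * j.+1%:R ^+ k.
    by rewrite mulr_ge0// exprn_ge0// ltW.
  apply/mx_norm_leP => [|l i].
    by rewrite divr_ge0// mulr_ge0// sumr_ge0.
  rewrite ler_pdivlMr ?ltr0n// mulrC (ord1 i); apply: le_trans (cP l j) _.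
  by rewrite ler_wpM2r// (bigD1 l)//= lerDl sumr_ge0.
suff [d dP] : dominated lam k (fun j =>
    \sum_l p 0 l * real_complex R ((A ^+ j *m v) l 0)).
  by exists d => j; rewrite E.
apply: dominated_sum => l _; apply: dominatedZ; exists c => j.
apply: le_trans (cP j); rewrite normc_real ler_wpM2l//.
exact: ler_entry_norm.
Qed.

(** Complex conjugation commutes with a real matrix. *)
Lemma dominated_conj (R : realType) n (A : 'M[R]_n) (lam : R) k (v : 'cV[R[i]]_n) :
  (forall p : 'rV_n, dominated lam k
     (fun j => (p *m map_mx (real_complex R) A ^+ j *m v) 0 0)) ->
  (forall p : 'rV_n, dominated lam k
     (fun j => (p *m map_mx (real_complex R) A ^+ j *m map_mx (@conjc R) v) 0 0)).
Proof.
move=> dom p; have [c cP] := dom (map_mx (@conjc R) p); exists c => j.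
have Mreal : map_mx (@conjc R) (map_mx (real_complex R) A) =
    map_mx (real_complex R) A.
  by apply/matrixP => r s; rewrite !mxE /= oppr0.
have pK : map_mx (@conjc R) (map_mx (@conjc R) p) = p.
  by apply/matrixP => r s; rewrite !mxE conjcK.
have -> : (p *m map_mx (real_complex R) A ^+ j *m map_mx (@conjc R) v) 0 0 =
    conjc ((map_mx (@conjc R) p *m map_mx (real_complex R) A ^+ j *m v) 0 0).
  transitivity (map_mx (@conjc R)
      (map_mx (@conjc R) p *m map_mx (real_complex R) A ^+ j *m v) 0 0).
    by rewrite !map_mxM map_mxX Mreal pK.
  by rewrite mxE.
by rewrite normc_conjc.
Qed.

Lemma row_rank_free (F : fieldType) n (s : seq 'rV[F]_n) : free s ->
  \rank (\matrix_(i < size s) s`_i : 'M[F]_(size s, n)) = size s.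
Proof.
rewrite -[s in free s]in_tupleE => /freeP fs.
set U := \matrix_(i < _) _; apply/eqP; rewrite -/(row_free U) -kermx_eq0.
apply/eqP/row_matrixP => i; rewrite row0; apply/rowP => l; rewrite [RHS]mxE.
apply: (fs (fun l => row i (kermx U) 0 l)).
have kU : row i (kermx U) *m U = 0 by rewrite -row_mul mulmx_ker row0.
rewrite -[RHS]kU mulmx_sum_row; apply: eq_bigr => m _.
by rewrite rowK.
Qed.

(** A conjugation invariant complex kernel is the complexification of a real
    one: the real and imaginary parts of U have the same row space as U. *)
Lemma real_kernel (R : realType) m n (U : 'M[R[i]]_(m, n)) :
  (forall v : 'cV[R[i]]_n, U *m v = 0 -> U *m map_mx (@conjc R) v = 0) ->
  exists2 V : 'M[R]_(m + m, n), (\rank V = \rank U)%N &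
    forall v : 'cV[R]_n, V *m v = 0 <-> U *m map_mx (real_complex R) v = 0.
Proof.
move=> Uconj; pose rc := real_complex R.
pose ReU := map_mx (@complex.Re R) U; pose ImU := map_mx (@complex.Im R) U.
pose Uc := map_mx (@conjc R) U.
have UE : U = map_mx rc ReU + 'i%C *: map_mx rc ImU.
  apply/matrixP => a b; rewrite !mxE; case: (U a b) => x y /=.
  by simpc.
have UcE : Uc = map_mx rc ReU - 'i%C *: map_mx rc ImU.
  apply/matrixP => a b; rewrite !mxE; case: (U a b) => x y /=.
  by simpc.
(* The columns of cokermx U span the kernel of U. *)
have UcU : (Uc <= U)%MS.
  rewrite submxE; apply/eqP/matrixP => a b; rewrite [RHS]mxE.
  have : U *m col b (cokermx U) = 0 by rewrite colE mulmxA mulmx_coker mul0mx.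
  move=> /Uconj /(congr1 (map_mx (@conjc R))); rewrite map_mxM map_mx0.
  have -> : map_mx (@conjc R) (map_mx (@conjc R) (col b (cokermx U))) =
      col b (cokermx U) by apply/matrixP => r s; rewrite !mxE conjcK.
  rewrite -/Uc colE mulmxA -colE => /matrixP/(_ a 0).
  by rewrite [LHS]mxE [RHS]mxE.
pose V := col_mx ReU ImU.
have two : (2 : R[i]) != 0 by rewrite pnatr_eq0.
have i0 : ('i%C : R[i]) != 0 by rewrite eq_complex /= oner_eq0 andbF.
have dbl (X : 'M[R[i]]_(m, n)) : X + X = 2 *: X by rewrite scaler_nat mulr2n.
have ReE : map_mx rc ReU = 2^-1 *: (U + Uc).
  rewrite UcE [X in _ *: (X + _)]UE addrACA subrr addr0 dbl.
  by rewrite scalerA mulVf// scale1r.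
have ImE : map_mx rc ImU = (2 * 'i%C)^-1 *: (U - Uc).
  rewrite UcE [X in _ *: (X - _)]UE opprB addrC addrA subrK dbl.
  by rewrite !scalerA mulVf ?scale1r// mulf_neq0.
have VU : (map_mx rc V == U)%MS.
  apply/andP; split.
    rewrite map_col_mx col_mx_sub ReE ImE.
    by rewrite !scalemx_sub// ?addmx_sub ?eqmx_opp.
  by rewrite UE addmx_sub// ?scalemx_sub// map_col_mx -addsmxE ?addsmxSl ?addsmxSr.
exists V; first by rewrite -(mxrank_map rc) (eqmxP VU).
move=> v; have VvE : map_mx rc (V *m v) = map_mx rc V *m map_mx rc v.
  exact: map_mxM.
have /andP[/submxP[X XE] /submxP[Y YE]] := VU.
split=> [v0|Uv0].
  by rewrite YE -mulmxA -VvE v0 map_mx0 mulmx0.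
apply: (@map_mx_inj _ _ rc); rewrite map_mx0.
by rewrite VvE XE -mulmxA Uv0 mulmx0.
Qed.

(** The chain tails are independent, being part of a basis, and they cut out the
    complex vectors of the given growth. This complex subspace is invariant
    under conjugation, hence defined over the reals. *)
Lemma growth_space (R : realType) n (A : 'M[R]_n)
    (cs : seq (R[i] * seq 'rV[R[i]]_n)) (lam : R) (k : nat) :
  let M := map_mx (real_complex R) A in
  A \in unitmx -> (forall b, b \in cs -> jordan_chain (row_action M) b) ->
  basis_of fullv (chain_vectors cs) -> 0 < lam ->
  exists m (U : 'M[R]_(m, n)),
    (forall v, U *m v = 0 <-> growth_le A lam k v) /\
    \rank U = (\sum_(b <- cs) tail_size lam k (normc b.1, size b.2))%N.
Proof.
move=> M Au csP csb lam0.
have Mu : M \in unitmx by rewrite map_unitmx.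
pose sel := flatten [seq chain_tail lam k b | b <- cs].
have fsel : free sel.
  apply: subseq_free (basis_free csb); rewrite /sel /chain_vectors.
  elim: (cs) => //= b s IHs; apply: cat_subseq => //.
  rewrite /chain_tail; case: ifP => // _; case: ifP => _; last exact: sub0seq.
  exact: drop_subseq.
have ssel : size sel = (\sum_(b <- cs) tail_size lam k (normc b.1, size b.2))%N.
  rewrite /sel; elim: (cs) => [|b s IHs]; first by rewrite big_nil.
  rewrite big_cons /= size_cat IHs; congr addn.
  rewrite /chain_tail /tail_size /=; case: ifP => // _; case: ifP => // _.
  by rewrite size_drop.
pose Uc := \matrix_(i < size sel) sel`_i : 'M[R[i]]_(size sel, n).
have UcP (v : 'cV[R[i]]_n) : Uc *m v = 0 <-> (forall x, x \in sel -> x *m v = 0).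
  split=> [Uv x /(nthP 0)[l ls <-]|xv].
    by have := congr1 (row (Ordinal ls)) Uv; rewrite row_mul rowK row0.
  by apply/row_matrixP => l; rewrite row_mul rowK row0 xv// mem_nth.
have domP v := dominated_iff_tail k v Mu csP csb lam0.
have Ucconj (v : 'cV[R[i]]_n) : Uc *m v = 0 -> Uc *m map_mx (@conjc R) v = 0.
  move=> Uv; apply/UcP; refine ((domP _).1 _); apply: dominated_conj.
  exact: (domP _).2 ((UcP v).1 Uv).
have [V rV VP] := real_kernel Ucconj.
exists (size sel + size sel)%N, V; split; last first.
  by rewrite rV row_rank_free.
move=> v; split=> [Vv|gr].
  refine ((dominated_real A k v lam0).1 _); refine ((domP _).2 _).
  exact: (UcP _).1 ((VP _).1 Vv).
refine ((VP _).2 _); refine ((UcP _).2 _); refine ((domP _).1 _).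
exact: (dominated_real A k v lam0).2.
Qed.

(** * Recovering the blocks from the growth dimensions *)

(** A block of size l and modulus lam contributes max(l - k, 0) as a function
    of k, whose second difference is concentrated at l = k + 1; larger moduli
    contribute a constant. *)
Lemma tail_size_second_difference (R : realType) (lam : R) k (s : seq (R * nat)) :
  (\sum_(b <- s) tail_size lam k b + \sum_(b <- s) tail_size lam k.+2 b =
   (\sum_(b <- s) tail_size lam k.+1 b).*2 + count_mem (lam, k.+1) s)%N.
Proof.
elim: s => [|[a K] s IHs]; first by rewrite !big_nil.
rewrite !big_cons /= addnACA {}IHs doubleD.
suff -> : (tail_size lam k (a, K) + tail_size lam k.+2 (a, K) =
    (tail_size lam k.+1 (a, K)).*2 + ((a, K) == (lam, k.+1)))%N by rewrite addnACA.
rewrite /tail_size /= xpair_eqE eq_sym; case: ltgtP => _ /=; rewrite ?andbF ?andbT ?addnn ?addn0//.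
by case: eqP => [->|/eqP]; clear; lia.
Qed.

Lemma perm_eq_of_tail_size (R : realType) (s1 s2 : seq (R * nat)) :
  (forall b, b \in s1 ++ s2 -> 0 < b.1 /\ (0 < b.2)%N) ->
  (forall lam k, 0 < lam ->
    (\sum_(b <- s1) tail_size lam k b = \sum_(b <- s2) tail_size lam k b)%N) ->
  perm_eq s1 s2.
Proof.
move=> pos eqN; apply/allP => -[a [|k]] bs /=; have [/= a0 //] := pos _ bs.
move=> _; rewrite -(eqn_add2l (\sum_(b <- s1) tail_size a k.+1 b).*2).
rewrite -tail_size_second_difference !eqN//.
by rewrite tail_size_second_difference.
Qed.

Lemma block_geq_total (R : realType) : total (@block_geq R).
Proof.
move=> [a k] [b l]; rewrite /block_geq /= [b == a]eq_sym.
by case: ltgtP => //= _; exact: leq_total.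
Qed.

Lemma block_geq_trans (R : realType) : transitive (@block_geq R).
Proof.
move=> [b l] [a k] [c m]; rewrite /block_geq /=.
move=> /orP[ba|/andP[/eqP -> lk]] /orP[cb|/andP[/eqP -> ml]].
- by rewrite (lt_trans cb ba).
- by rewrite ba.
- by rewrite cb.
- by rewrite eqxx (leq_trans ml lk) orbT.
Qed.

Lemma block_geq_anti (R : realType) : antisymmetric (@block_geq R).
Proof.
move=> [a k] [b l]; rewrite /block_geq /= [b == a]eq_sym.
by case: ltgtP => //= -> /anti_leq ->.
Qed.

Lemma sum_block_sizes (T : Type) (s : seq (T * nat)) :
  (\sum_(i < size s) (tnth (in_tuple s) i).2 = sumn (map snd s))%N.
Proof. by rewrite sumnE big_map [RHS]big_tnth. Qed.

Lemma is_jordan_mx_exists (F : nzRingType) n (s : seq (F * nat)) :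
  all (fun b => 0 < b.2)%N s -> sumn (map snd s) = n ->
  exists J : 'M[F]_n, is_jordan_mx J s.
Proof.
rewrite -sum_block_sizes => pos e; exists (castmx (e, e) (jordan_mx s)).
by split=> //; exists e.
Qed.

Lemma castmx_rows_mul (F : fieldType) n m (e : m = n) (J : 'M[F]_m)
    (P : 'M[F]_(m, n)) :
  castmx (e, erefl n) (J *m P) =
  castmx (e, e) J *m castmx (e, erefl n) P.
Proof. by move: P; case: n / e => P; rewrite !castmx_id. Qed.

Lemma castmx_rows_mul_r (F : fieldType) n m p q (e : m = n) (P : 'M[F]_(m, p))
    (M : 'M[F]_(p, q)) :
  castmx (e, erefl p) P *m M = castmx (e, erefl q) (P *m M).
Proof. by case: n / e; rewrite !castmx_id. Qed.

(** Stacking the chains as rows gives P with P M = J P. The rows span, so P is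
    invertible once its height is identified with n. *)
Lemma jordan_form_exists (F : numClosedFieldType) n (M : 'M[F]_n)
    (cs : seq (F * seq 'rV[F]_n)) :
  (forall b, b \in cs -> jordan_chain (row_action M) b) ->
  basis_of fullv (chain_vectors cs) ->
  sumn (map snd [seq (b.1, size b.2) | b <- cs]) = n /\
  exists J : 'M[F]_n, jordan_form_of M J [seq (b.1, size b.2) | b <- cs].
Proof.
move=> csP csb; set s := [seq (b.1, size b.2) | b <- cs].
have sumE : sumn (map snd s) = n.
  have := size_basis (csb : basis_of _ (in_tuple (chain_vectors cs))).
  rewrite dimvf /dim /= mul1n => ->; rewrite size_flatten /shape /s -!map_comp.
  by congr sumn; apply: eq_map.
split=> //.
have pos : all (fun b => 0 < b.2)%N s.
  by apply/allP => _ /mapP[b bcs ->]; have [] := csP _ bcs.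
have e := sum_block_sizes s; rewrite sumE in e.
exists (castmx (e, e) (jordan_mx s)); split; first by split=> //; exists e.
have szs : size s = size cs by rewrite size_map.
pose x0 : F * seq 'rV[F]_n := (0, [::]).
have sE (i : 'I_(size s)) : tnth (in_tuple s) i =
    ((nth x0 cs i).1, size (nth x0 cs i).2).
  by rewrite (tnth_nth (0, 0%N)) /= (nth_map x0)// -szs.
have s1E (i : 'I_(size s)) : (tnth (in_tuple s) i).1 = (nth x0 cs i).1.
  by rewrite sE.
have s2E (i : 'I_(size s)) :
  size (nth x0 cs i).2 = (tnth (in_tuple s) i).2 by rewrite sE.
have memcs (i : 'I_(size s)) : nth x0 cs i \in cs by rewrite mem_nth// -szs.
pose B (i : 'I_(size s)) : 'M[F]_((tnth (in_tuple s) i).2, n) :=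
  \matrix_(l < (tnth (in_tuple s) i).2) (nth x0 cs i).2`_l.
pose P := \mxcol_i B i.
have PM : P *m M = jordan_mx s *m P.
  rewrite mxcol_mul mul_mxdiag_mxcol; apply: eq_mxcol => i.
  have [_ chb] := csP _ (memcs i).
  apply/row_matrixP => l; rewrite row_mul rowK.
  have lsz : (l < size (nth x0 cs i).2)%N by rewrite s2E.
  have := chb _ lsz; rewrite row_actionE => ->.
  rewrite row_mul mulmx_sum_row.
  have rowJ m : row l (jordan_block (tnth (in_tuple s) i).1
      (tnth (in_tuple s) i).2) 0 m =
      (nth x0 cs i).1 *+ (l == m) + (l.+1 == m :> nat)%:R.
    by rewrite !mxE s1E.
  under eq_bigr do rewrite rowJ rowK scalerDl.
  rewrite big_split /= (bigD1 l)//= eqxx mulr1n big1 => [|m ml]; last first.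
    by rewrite eq_sym (negPf ml) mulr0n scale0r.
  rewrite addr0; congr (_ + _).
  have [l1|l1] := ltnP l.+1 (tnth (in_tuple s) i).2.
    rewrite (bigD1 (Ordinal l1))//= eqxx scale1r big1 ?addr0// => m ml.
    rewrite (_ : (l.+1 == m) = false) ?scale0r//.
    by apply/negbTE; apply: contraNneq ml => lm; apply/eqP/val_inj.
  rewrite nth_default ?s2E//.
  rewrite big1// => m _; rewrite (_ : (l.+1 == m) = false) ?scale0r//.
  by apply/negbTE; rewrite neq_ltn (leq_trans (ltn_ord m))// orbT.
have Pfull : row_full P.
  rewrite -cokermx_eq0; apply/eqP.
  have P0 : P *m cokermx P = 0 by exact: mulmx_coker.
  have chain0 x : x \in chain_vectors cs -> x *m cokermx P = 0.
    move=> /chain_vectorsP[b /(nthP x0)[r rcs <-] /(nthP 0)[l lsz <-]].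
    have rs : (r < size s)%N by rewrite szs.
    have ls : (l < (tnth (in_tuple s) (Ordinal rs)).2)%N by rewrite -s2E.
    move: P0; rewrite mxcol_mul => /(congr1 (fun X => submxcol X (Ordinal rs))).
    rewrite mxcolK submxcol0 => /(congr1 (row (Ordinal ls))).
    by rewrite row_mul rowK row0.
  have all0 (x : 'rV[F]_n) : x *m cokermx P = 0.
    have : x \in <<chain_vectors cs>>%VS by rewrite (span_basis csb) memvf.
    rewrite -[chain_vectors cs]in_tupleE => /coord_span ->.
    rewrite mulmx_suml big1// => l _; rewrite -scalemxAl chain0 ?scaler0//.
    by rewrite mem_nth.
  by rewrite -[LHS]mul1mx; apply/row_matrixP => l; rewrite row_mul all0 row0.
exists (castmx (e, erefl n) P); last first.
  apply: simmxW.
    by rewrite row_free_unit -row_full_unit /row_full eqmx_cast.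
  rewrite -castmx_rows_mul -PM.
  by rewrite castmx_rows_mul_r.
by rewrite -row_full_unit /row_full eqmx_cast.
Qed.

(** F preserves growth, so it maps cosets of the growth subspaces of A into
    cosets of those of B; tail_size sums up to the codimensions. *)
Lemma tail_sizes_le (R : realType) n (A B : 'M[R]_n) (F : 'cV[R]_n -> 'cV[R]_n)
    (K : R) (csA csB : seq (R[i] * seq 'rV[R[i]]_n)) (lam : R) k :
  let MA := map_mx (real_complex R) A in
  let MB := map_mx (real_complex R) B in
  A \in unitmx -> B \in unitmx ->
  (forall b, b \in csA -> jordan_chain (row_action MA) b) ->
  basis_of fullv (chain_vectors csA) ->
  (forall b, b \in csB -> jordan_chain (row_action MB) b) ->
  basis_of fullv (chain_vectors csB) ->
  0 < K ->
  (forall j x x', `|B ^+ j *m (F x - F x')| <= K * `|A ^+ j *m (x - x')|) ->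
  (forall j x x', `|A ^+ j *m (x - x')| <= K * `|B ^+ j *m (F x - F x')|) ->
  0 < lam ->
  (\sum_(b <- csB) tail_size lam k (normc b.1, size b.2) <=
   \sum_(b <- csA) tail_size lam k (normc b.1, size b.2))%N.
Proof.
move=> MA MB Au Bu csAP csAb csBP csBb K0 leBA leAB lam0.
have [mA [UA [UAP <-]]] := growth_space k Au csAP csAb lam0.
have [mB [UB [UBP <-]]] := growth_space k Bu csBP csBb lam0.
apply: (@mxrank_le_of_lipschitz _ _ _ _ UA UB F K) => //.
- by move=> x x'; have := leAB 0%N x x'; rewrite !expr0 !mul1mx.
- by move=> x x'; have := leBA 0%N x x'; rewrite !expr0 !mul1mx.
move=> x x' /UAP[c cP]; apply/UBP; exists (K * c) => j.
rewrite -mulrA -ler_pdivrMl// mulrCA; apply: le_trans (cP j).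
by rewrite ler_wpM2l// ler_pdivrMl.
Qed.

Lemma same_absolute_jordan_form_of_bilipschitz (R : realType) n
    (A B : 'M[R]_n) (F G : 'cV[R]_n -> 'cV[R]_n) (K : R) :
  A \in unitmx -> B \in unitmx -> cancel G F -> 0 < K ->
  (forall j x x', `|B ^+ j *m (F x - F x')| <= K * `|A ^+ j *m (x - x')|) ->
  (forall j x x', `|A ^+ j *m (x - x')| <= K * `|B ^+ j *m (F x - F x')|) ->
  same_absolute_jordan_form A B.
Proof.
move=> Au Bu GK K0 leBA leAB.
pose MA := map_mx (real_complex R) A; pose MB := map_mx (real_complex R) B.
have MAu : MA \in unitmx by rewrite map_unitmx.
have MBu : MB \in unitmx by rewrite map_unitmx.
have [csA [csAP csAb]] := jordan_basis (subvf (row_action MA @: fullv)%VS).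
have [csB [csBP csBb]] := jordan_basis (subvf (row_action MB @: fullv)%VS).
have [sumA [JA jfA]] := jordan_form_exists csAP csAb.
have [sumB [JB jfB]] := jordan_form_exists csBP csBb.
pose abs_blocks (cs : seq (R[i] * seq 'rV[R[i]]_n)) :=
  [seq (normc b.1, b.2) | b <- [seq (b.1, size b.2) | b <- cs]].
have permAB : perm_eq (abs_blocks csA) (abs_blocks csB).
  apply: perm_eq_of_tail_size => [b|lam k lam0].
    rewrite mem_cat => /orP[] /mapP[_ /mapP[c cc ->] ->] /=; rewrite normc_gt0.
      split; last by have [] := csAP _ cc.
      exact: (chain_eigenvalue_neq0 MAu csAP (basis_free csAb)).
    split; last by have [] := csBP _ cc.
    exact: (chain_eigenvalue_neq0 MBu csBP (basis_free csBb)).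
  rewrite !big_map /=; apply/eqP; rewrite eqn_leq; apply/andP; split.
    apply: (@tail_sizes_le _ _ B A G K) => // j x x'.
      by have := leAB j (G x) (G x'); rewrite !GK.
    by have := leBA j (G x) (G x'); rewrite !GK.
  exact: (@tail_sizes_le _ _ A B F K).
have sortE : sort (@block_geq R) (abs_blocks csA) = sort (@block_geq R) (abs_blocks csB).
  apply/(perm_sortP (@block_geq_total R) (@block_geq_trans R) (@block_geq_anti R)).
  exact: permAB.
have [J JP] : exists J : 'M[R]_n,
    is_jordan_mx J (sort (@block_geq R) (abs_blocks csA)).
  apply: is_jordan_mx_exists.
    rewrite all_sort /abs_blocks all_map.
    by apply/allP => _ /mapP[b bcs ->] /=; have [] := csAP _ bcs.
  rewrite -[RHS]sumA; apply: perm_sumn.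
  apply: (@perm_trans _ (map snd (abs_blocks csA))).
    by apply: perm_map; rewrite perm_sort.
  by rewrite /abs_blocks -map_comp.
exists J; split.
  by exists JA, [seq (b.1, size b.2) | b <- csA]; split; [exact: jfA|exact: JP].
exists JB, [seq (b.1, size b.2) | b <- csB]; split; first exact: jfB.
by move: JP; rewrite sortE.
Qed.

(** * Lengths of curves *)

Lemma gm_normE (R : realType) n (Mt : R -> 'M[R]_n) (p v : 'cV[R]_n * R) :
  gm_norm Mt p v =
  Num.sqrt (\sum_i ((Mt (- p.2) *m v.1) i 0) ^+ 2 + v.2 ^+ 2).
Proof.
rewrite /gm_norm /gm_Q !mulmxA -trmx_mul -mulmxA mxE; congr (Num.sqrt (_ + _)).
by apply: eq_bigr => i _; rewrite mxE expr2.
Qed.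

Lemma gm_norm_ge_vertical (R : realType) n (Mt : R -> 'M[R]_n)
    (p v : 'cV[R]_n * R) : `|v.2| <= gm_norm Mt p v.
Proof.
rewrite gm_normE -sqrtr_sqr ler_wsqrtr// lerDr sumr_ge0// => i _.
exact: sqr_ge0.
Qed.

Lemma gm_norm_ge_horizontal (R : realType) n (Mt : R -> 'M[R]_n)
    (p v : 'cV[R]_n * R) : `|Mt (- p.2) *m v.1| <= gm_norm Mt p v.
Proof.
apply/mx_norm_leP => [|i j]; first exact: sqrtr_ge0.
rewrite gm_normE (ord1 j) -sqrtr_sqr ler_wsqrtr// (bigD1 i)//= -addrA lerDl.
by rewrite addr_ge0 ?sqr_ge0// sumr_ge0// => k _; exact: sqr_ge0.
Qed.

Lemma gm_norm_le (R : realType) n (Mt : R -> 'M[R]_n) (p v : 'cV[R]_n * R) :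
  gm_norm Mt p v <= n%:R * `|Mt (- p.2) *m v.1| + `|v.2|.
Proof.
set w := _ *m _; have pos : 0 <= n%:R * `|w| by rewrite mulr_ge0.
have pos2 : 0 <= n%:R * `|w| + `|v.2| by rewrite addr_ge0.
rewrite gm_normE -/w -(ger0_norm pos2) -sqrtr_sqr ler_wsqrtr//.
rewrite sqrrD -[leRHS]addrA lerD//; last first.
  rewrite -[leLHS]add0r lerD ?mulrn_wge0 ?mulr_ge0//.
  by rewrite -normrX ger0_norm ?sqr_ge0.
apply: (@le_trans _ _ (\sum_(i < n) `|w| ^+ 2)).
  apply: ler_sum => i _; rewrite -[leLHS]ger0_norm ?sqr_ge0// normrX.
  by rewrite lerXn2r ?nnegrE// ler_entry_norm.
rewrite sumr_const card_ord -[leLHS]mulr_natl exprMn ler_wpM2r ?sqr_ge0//.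
by rewrite expr2 -natrM ler_nat; case: (n) => // m; rewrite leq_pmulr.
Qed.

Lemma continuous_gm_norm (R : realType) n (Mt : R -> 'M[R]_n)
    (g v : R -> 'cV[R]_n * R) :
  continuous Mt -> continuous g -> continuous v ->
  continuous (fun u => gm_norm Mt (g u) (v u)).
Proof.
move=> cM cg cv.
have -> : (fun u => gm_norm Mt (g u) (v u)) = (fun u => Num.sqrt
    (\sum_i (\sum_k Mt (- (g u).2) i k * (v u).1 k 0) ^+ 2 + (v u).2 ^+ 2)).
  apply/funext => u; rewrite gm_normE; congr (Num.sqrt (_ + _)).
  by apply: eq_bigr => i _; rewrite mxE.
pose S u := \sum_i (\sum_k Mt (- (g u).2) i k * (v u).1 k 0) ^+ 2 + (v u).2 ^+ 2.
move=> u; suff cS : S x @[x --> u] --> S u.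
  exact: (cvg_comp _ _ cS (@sqrt_continuous R (S u))).
have cv2 : (v x).2 @[x --> u] --> (v u).2 by exact: (cvg_comp _ _ (cv u) cvg_snd).
have cv1 : (v x).1 @[x --> u] --> (v u).1 by exact: (cvg_comp _ _ (cv u) cvg_fst).
have cg2 : (g x).2 @[x --> u] --> (g u).2 by exact: (cvg_comp _ _ (cg u) cvg_snd).
apply: cvgD; last by rewrite !expr2; apply: cvgM.
apply: cvg_big => [|i _]; first exact: add_continuous.
have c1 : (\sum_k Mt (- (g x).2) i k * (v x).1 k 0) @[x --> u] -->
    \sum_k Mt (- (g u).2) i k * (v u).1 k 0.
  apply: cvg_big => [|k _]; first exact: add_continuous.
  have cMg : Mt (- (g x).2) @[x --> u] --> Mt (- (g u).2).
    exact: (cvg_comp _ _ (cvgN cg2) (cM _)).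
  apply: cvgM.
    exact: (cvg_comp _ _ cMg (@coord_continuous _ _ _ i k _)).
  exact: (cvg_comp _ _ cv1 (@coord_continuous _ _ _ k 0 _)).
by rewrite !expr2; apply: cvgM.
Qed.

(** A continuous linear functional commutes with the limit defining the
    derivative. *)
Lemma derive1_linear_comp (R : realType) (V : normedModType R) (psi : V -> R)
    (g : R -> V) (u : R) :
  (forall a x y, psi (a *: x + y) = a * psi x + psi y) -> continuous psi ->
  derivable g u 1 ->
  derivable (psi \o g : R -> R^o) u 1 /\ derive1 (psi \o g : R -> R^o) u = psi (derive1 g u).
Proof.
move=> lpsi cpsi dg.
have psi0 : psi 0 = 0.
  by have := lpsi 1 0 0; rewrite scale1r addr0 mul1r => h; lra.
have psiE a x y : a * (psi x - psi y) = psi (a *: (x - y)).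
  rewrite -[a *: _]addr0 lpsi psi0 addr0; congr (_ * _).
  have := lpsi (-1) y x; rewrite scaleN1r [- y + x]addrC => ->; ring.
have cv : (fun h : R => h^-1 *: (psi (g (h *: 1 + u)) - psi (g u)) : R^o) @ 0^'
    --> psi ('D_1 g u).
  have -> : (fun h : R => h^-1 *: (psi (g (h *: 1 + u)) - psi (g u)) : R^o) =
    psi \o (fun h : R => h^-1 *: (g (h *: 1 + u) - g u)).
    by apply/funext => h; exact: psiE.
  by apply: cvg_comp; [exact: dg|exact: cpsi].
split; first by apply/cvg_ex; exists (psi ('D_1 g u)).
by rewrite !derive1E; apply: cvg_lim.
Qed.

Definition gm_speed (R : realType) n (Mt : R -> 'M[R]_n)
  (c : R -> 'cV[R]_n * R) (u : R) : R := gm_norm Mt (c u) (derive1 c u).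

Lemma gm_norm_ge0 (R : realType) n (Mt : R -> 'M[R]_n) p v : 0 <= gm_norm Mt p v.
Proof. exact: sqrtr_ge0. Qed.

Lemma integrable_setU (d : measure_display) (T : measurableType d) (R : realType)
    (mu : {measure set T -> \bar R}) (A B : set T) (f : T -> \bar R) :
  measurable A -> measurable B -> [disjoint A & B] ->
  mu.-integrable A f -> mu.-integrable B f -> mu.-integrable (A `|` B) f.
Proof.
move=> mA mB dAB /integrableP[mfA iA] /integrableP[mfB iB].
have mfU : measurable_fun (A `|` B) f by exact/measurable_funU.
apply/integrableP; split=> //; rewrite ge0_integral_setU//.
  exact: lte_add_pinfty.
exact: measurableT_comp.
Qed.

Lemma C1_derivable_continuous (R : realType) (V : normedModType R) (g : R -> V) :
  C1 g -> continuous g.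
Proof.
by move=> [dg _] u; apply: differentiable_continuous; exact/derivable1_diffP.
Qed.

Lemma eq_itvoo_derive1 (R : realType) (V : normedModType R) (a b : R) (c g : R -> V) :
  {in `[a, b], c =1 g} -> {in `]a, b[, derive1 c =1 derive1 g}.
Proof.
move=> cg u uab; rewrite !derive1E; apply: near_eq_derive.
near=> x; apply: cg; apply: subset_itv_oo_cc.
near: x; exact: near_in_itvoo.
Unshelve. all: by end_near. Qed.

(** At the end points of a piece the derivative of c may be junk, but two points
    do not matter for the integral. *)
Lemma gm_speed_piece (R : realType) n (Mt : R -> 'M[R]_n) (a b : R)
    (c g : R -> 'cV[R]_n * R) :
  continuous Mt -> C1 g -> {in `[a, b], c =1 g} ->
  (@lebesgue_measure R).-integrable `[a, b] (EFin \o gm_speed Mt c) /\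
  \int[@lebesgue_measure R]_(x in `[a, b]) gm_speed Mt c x =
  \int[@lebesgue_measure R]_(x in `[a, b]) gm_speed Mt g x.
Proof.
move=> cM C1g cg; have [dg cdg] := C1g.
have cspeed : continuous (gm_speed Mt g).
  by apply: continuous_gm_norm => //; exact: C1_derivable_continuous.
have mspeed D : measurable D -> measurable_fun D (gm_speed Mt g).
  move=> mD; apply: (@measurable_funS _ _ _ _ setT) => //.
  exact: continuous_measurable_fun.
have speedE : {in `]a, b[, gm_speed Mt c =1 gm_speed Mt g}.
  move=> u uab; rewrite /gm_speed (eq_itvoo_derive1 cg uab) cg//.
  exact: subset_itv_oo_cc.
have mc : measurable_fun `]a, b[ (gm_speed Mt c).
  apply: (@eq_measurable_fun _ _ _ _ _ (gm_speed Mt g)); last exact: mspeed.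
  by move=> u; rewrite inE => uab; rewrite speedE.
have intg : (@lebesgue_measure R).-integrable `[a, b] (EFin \o gm_speed Mt g).
  apply: continuous_compact_integrable; first exact: segment_compact.
  exact: continuous_subspaceT.
have intE : (\int[@lebesgue_measure R]_(x in `[a, b]) (gm_speed Mt c x)%:E =
  \int[@lebesgue_measure R]_(x in `[a, b]) (gm_speed Mt g x)%:E)%E.
  have mg : measurable_fun `]a, b[ (gm_speed Mt g) by apply: mspeed.
  exact: (@eq_integral_itv_bounded R a b _ _ true false mc mg speedE).
split; last exact: (congr1 fine intE).
apply/integrableP; split.
  by apply: (@emeasurable_fun_itv_cc _ _ _ false true); exact/measurable_EFinP.
have absE f : (\int[@lebesgue_measure R]_(x in `[a, b])
      `|(EFin \o gm_speed Mt f) x| =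
    \int[@lebesgue_measure R]_(x in `[a, b]) (gm_speed Mt f x)%:E)%E.
  apply: eq_integral => x _; apply: gee0_abs.
  by rewrite lee_fin; exact: gm_norm_ge0.
have /integrableP[_ ig] := intg; apply: le_lt_trans ig.
by rewrite le_eqVlt; apply/orP; left; apply/eqP;
   exact: (etrans (absE c) (etrans intE (esym (absE g)))).
Qed.

(** The fundamental theorem of calculus for psi o g. *)
Lemma displacement_le_length_piece (R : realType) n (Mt : R -> 'M[R]_n) (a b L : R)
    (psi : 'cV[R]_n * R -> R) (c g : R -> 'cV[R]_n * R) :
  continuous Mt -> C1 g -> {in `[a, b], c =1 g} ->
  (forall a x y, psi (a *: x + y) = a * psi x + psi y) -> continuous psi ->
  0 <= L ->
  (forall u v, u \in `[a, b] -> `|psi v| <= L * gm_norm Mt (c u) v) ->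
  forall u, u \in `[a, b] ->
  `|psi (c u) - psi (c a)| <=
    L * \int[@lebesgue_measure R]_(x in `[a, b]) gm_speed Mt c x.
Proof.
move=> cM C1g cg lpsi cpsi L0 psiL u uab.
have [iab ->] := gm_speed_piece cM C1g cg.
have [dg cdg] := C1g; have cgc := C1_derivable_continuous C1g.
have /andP[au ub] : a <= u <= b by move: uab; rewrite in_itv.
have ab : a <= b by exact: le_trans ub.
rewrite !cg//; last by rewrite in_itv /= lexx.
have int0 : 0 <= \int[@lebesgue_measure R]_(x in `[a, b]) gm_speed Mt g x.
  by apply: Rintegral_ge0 => x _; exact: gm_norm_ge0.
have [au'|au'] := ltP a u; last first.
  have -> : u = a by apply/eqP; rewrite eq_le au' au.
  by rewrite subrr normr0 mulr_ge0.
have cspeed : continuous (gm_speed Mt g) by exact: continuous_gm_norm.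
have cpsi' : continuous (psi \o derive1 g : R -> R^o).
  by move=> x; apply: cvg_comp; [exact: cdg|exact: cpsi].
have intc (f : R -> R^o) x : continuous f ->
    (@lebesgue_measure R).-integrable `[a, x] (EFin \o f).
  move=> cf; apply: continuous_compact_integrable; first exact: segment_compact.
  exact: continuous_subspaceT.
have FTC : \int[@lebesgue_measure R]_(x in `[a, u]) (psi \o derive1 g) x =
    psi (g u) - psi (g a).
  have cpg : continuous (psi \o g : R -> R^o).
    by move=> x; apply: cvg_comp; [exact: cgc|exact: cpsi].
  rewrite /Rintegral (@continuous_FTC2 _ _ (psi \o g : R -> R^o) _ _ au')//.
  - exact: continuous_subspaceT.
  - split.
    + by move=> x _; have [] := derive1_linear_comp lpsi cpsi (dg x).
    + by apply: cvg_at_right_filter; exact: cpg.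
    + by apply: cvg_at_left_filter; exact: cpg.
  - by move=> x _; have [] := derive1_linear_comp lpsi cpsi (dg x).
rewrite -FTC; apply: le_trans (le_normr_Rintegral _ _) _ => //.
  exact: intc.
apply: (@le_trans _ _ (\int[@lebesgue_measure R]_(x in `[a, u]) (L * gm_speed Mt g x))).
  apply: le_Rintegral => //.
  - by apply: intc => x; apply: cvg_comp; [exact: cpsi'|exact: norm_continuous].
  - apply: intc => x; apply: cvgM; [exact: cvg_cst|exact: cspeed].
  - move=> x /= xau; have xab : x \in `[a, b].
      move: xau; rewrite !in_itv /= => /andP[-> xu] /=; exact: le_trans ub.
    by rewrite /gm_speed -cg//; exact: psiL.
have mau : measurable (`[a, u] : set R) by [].
have intZ : \int[@lebesgue_measure R]_(x in `[a, u]) (L * gm_speed Mt g x) =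
    L * \int[@lebesgue_measure R]_(x in `[a, u]) gm_speed Mt g x.
  exact: (@RintegralZl _ _ R (@lebesgue_measure R) _ _ L mau (intc _ u cspeed)).
apply: (@le_trans _ _ (L * \int[@lebesgue_measure R]_(x in `[a, u]) gm_speed Mt g x)).
  by rewrite le_eqVlt; apply/orP; left; apply/eqP; exact: intZ.
apply: ler_wpM2l => //.
have mab : measurable (`[a, b] : set R) by [].
apply: fine_le.
- exact: (@integrable_fin_num _ _ R (@lebesgue_measure R) _ mau _ (intc _ u cspeed)).
- exact: (@integrable_fin_num _ _ R (@lebesgue_measure R) _ mab _ (intc _ b cspeed)).
apply: ge0_subset_integral => //.
- apply/measurable_EFinP; apply: (@measurable_funS _ _ _ _ setT) => //.
  exact: continuous_measurable_fun.
- by move=> x _; rewrite lee_fin gm_norm_ge0.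
- by apply: subset_itvl; rewrite bnd_simp.
Qed.

(** A functional bounded by L times the metric along the curve moves by at most
    L times the length. Stating it for all u in [a, b] allows its use first for
    the height, which confines the curve to a band, and then for the horizontal
    coordinates, whose norms are comparable inside this band. *)
Lemma displacement_le_length (R : realType) n (Mt : R -> 'M[R]_n) (a b L : R)
    (psi : 'cV[R]_n * R -> R) (c : R -> 'cV[R]_n * R) :
  continuous Mt -> piecewise_C1 a b c ->
  (forall a x y, psi (a *: x + y) = a * psi x + psi y) -> continuous psi ->
  0 <= L ->
  (forall u v, u \in `[a, b] -> `|psi v| <= L * gm_norm Mt (c u) v) ->
  forall u, u \in `[a, b] ->
  `|psi (c u) - psi (c a)| <=
    L * \int[@lebesgue_measure R]_(x in `[a, b]) gm_speed Mt c x.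
Proof.
move=> cM [s sab sP] lpsi cpsi L0.
suff : (@lebesgue_measure R).-integrable `[a, b] (EFin \o gm_speed Mt c) /\
  ((forall u v, u \in `[a, b] -> `|psi v| <= L * gm_norm Mt (c u) v) ->
  forall u, u \in `[a, b] ->
  `|psi (c u) - psi (c a)| <=
    L * \int[@lebesgue_measure R]_(x in `[a, b]) gm_speed Mt c x) by case.
elim: s a sab sP => [|x s IHs] a sab sP.
  have ab := itv_partition_nil sab; rewrite ab set_itv1; split.
    by apply/integrableP; split; [exact: measurable_fun_set1|rewrite integral_set1].
  move=> _ u; rewrite in_itv /= -eq_le => /eqP ->; rewrite subrr normr0.
  by rewrite mulr_ge0// Rintegral_ge0// => y _; exact: gm_norm_ge0.
have [sax _] := sab; have /= /andP[ax _] := sax.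
have sxb := itv_partition_cons sab; have xb := itv_partition_le sxb.
have [ix IHx] := IHs x sxb (fun i si => sP i.+1 si).
have [g C1g cg] := sP 0%N isT; rewrite /= in cg.
have [ia _] := gm_speed_piece cM C1g cg.
have abE : `[a, b]%classic = `[a, x]%classic `|` `]x, b]%classic :> set R.
  by rewrite -itv_bndbnd_setU ?bnd_simp// ltW.
have dis : [disjoint `[a, x]%classic & `]x, b]%classic]%classic.
  apply/disj_setPS => y [] /=; rewrite !in_itv /= => /andP[_ yx] /andP[xy _].
  by move: (le_lt_trans yx xy); rewrite ltxx.
have ixo : (@lebesgue_measure R).-integrable `]x, b] (EFin \o gm_speed Mt c).
  by apply: integrableS ix => //; apply: subset_itvr; rewrite bnd_simp.
have iab : (@lebesgue_measure R).-integrable `[a, b] (EFin \o gm_speed Mt c).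
  by rewrite abE; apply: integrable_setU.
split=> // psiL u uab.
have intE : \int[@lebesgue_measure R]_(y in `[a, b]) gm_speed Mt c y =
    \int[@lebesgue_measure R]_(y in `[a, x]) gm_speed Mt c y +
    \int[@lebesgue_measure R]_(y in `[x, b]) gm_speed Mt c y.
  rewrite -(Rintegral_itv_obnd_cbnd ixo) abE Rintegral_setU//.
  by rewrite -abE.
have int0 (D : set R) : 0 <= \int[@lebesgue_measure R]_(y in D) gm_speed Mt c y.
  by apply: Rintegral_ge0 => y _; exact: gm_norm_ge0.
have psiLa (y : R) v : y \in `[a, x] -> `|psi v| <= L * gm_norm Mt (c y) v.
  move=> yax; apply: psiL; move: yax; rewrite !in_itv /= => /andP[-> yx] /=.
  exact: le_trans xb.
have psiLx (y : R) v : y \in `[x, b] -> `|psi v| <= L * gm_norm Mt (c y) v.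
  move=> yax; apply: psiL; move: yax; rewrite !in_itv /= => /andP[xy ->].
  by rewrite (le_trans (ltW ax) xy).
have dispa := displacement_le_length_piece cM C1g cg lpsi cpsi L0 psiLa.
rewrite intE mulrDr; have [ux|xu] := leP u x.
  apply: (le_trans (dispa u _)); last by rewrite lerDl mulr_ge0.
  by move: uab; rewrite !in_itv /= ux => /andP[->].
rewrite -(subrK (psi (c x)) (psi (c u))) -addrA addrC.
apply: le_trans (ler_normD _ _) _; rewrite lerD//.
  by apply: dispa; rewrite in_itv /= lexx ltW.
apply: IHx => //.
by move: uab; rewrite !in_itv /= (ltW xu) => /andP[_ ->].
Qed.

(** * Distances against coordinates *)

Lemma one_param_factor (R : realType) n (Mt : R -> 'M[R]_n) (s t : R) p
    (x : 'M[R]_(n, p)) : one_param_subgroup Mt ->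
  Mt s *m x = Mt (s - t) *m (Mt t *m x).
Proof. by move=> [_ _ MD]; rewrite mulmxA -MD subrK. Qed.

Lemma one_param_bounded (R : realType) n (Mt : R -> 'M[R]_n) (D : R) :
  one_param_subgroup Mt -> 0 <= D ->
  exists2 E : R, 0 <= E & forall s (x : 'cV[R]_n), `|s| <= D ->
    `|Mt s *m x| <= E * `|x|.
Proof.
move=> [cM _ _] D0.
have DD : - D <= D by rewrite ge0_cp.
have cN : {within `[- D, D], continuous (fun s => `|Mt s|)}.
  apply: continuous_subspaceT => s; apply: cvg_norm; exact: cM.
have [c _ cmax] := EVT_max DD cN.
exists (n%:R * `|Mt c|) => [|s x sD]; first by rewrite mulr_ge0.
apply: le_trans (mulmx_norm_le _ _) _; rewrite ler_wpM2r// ler_wpM2l//.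
by apply: cmax; rewrite in_itv /= -ler_norml.
Qed.

Lemma line_derivative (R : realType) (V : normedModType R) (p w : V) (u : R) :
  derivable (fun u : R => p + u *: w) u 1 /\ derive1 (fun u : R => p + u *: w) u = w.
Proof.
have cv : (fun h : R => h^-1 *: ((p + (h *: 1 + u) *: w) - (p + u *: w))) @ 0^'
    --> w.
  apply: cvg_near_cst; near=> h.
  have h0 : h != 0 by near: h; exact: nbhs_dnbhs_neq.
  rewrite opprD addrACA subrr add0r -scalerBl addrK scalerA.
  by rewrite [h *: 1]mulr1 mulVf// scale1r.
split; first by apply/cvg_ex; exists w.
by rewrite derive1E; apply: cvg_lim.
Unshelve. all: by end_near. Qed.

Lemma line_C1 (R : realType) (V : normedModType R) (p w : V) :
  C1 (fun u : R => p + u *: w).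
Proof.
split=> [u|]; first by have [] := line_derivative p w u.
have -> : derive1 (fun u : R => p + u *: w) = cst w.
  by apply/funext => u; have [] := line_derivative p w u.
by move=> u; exact: cvg_cst.
Qed.

Definition segment_curve (R : realType) (V : lmodType R) (p q : V) (u : R) : V :=
  p + u *: (q - p).

Lemma segment_piecewise_C1 (R : realType) (V : normedModType R) (p q : V) :
  piecewise_C1 0 1 (segment_curve p q : R -> V).
Proof.
exists [:: 1]; first exact: itv_partition1.
by move=> i _; exists (segment_curve p q : R -> V) => //; exact: line_C1.
Qed.

Lemma gm_length_ge0 (R : realType) n (Mt : R -> 'M[R]_n) c : 0 <= gm_length Mt c.
Proof. by apply: Rintegral_ge0 => x _; exact: gm_norm_ge0. Qed.

Lemma gm_lengths_has_inf (R : realType) n (Mt : R -> 'M[R]_n) (p q : gm_carrier R n) :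
  has_inf [set gm_length Mt c | c in
        [set c : R -> 'cV[R]_n * R |
          [/\ piecewise_C1 0 1 c, c 0 = p & c 1 = q]]].
Proof.
split; last by exists 0 => _ [c _ <-]; exact: gm_length_ge0.
exists (gm_length Mt (segment_curve p q)), (segment_curve p q) => //; split.
- exact: segment_piecewise_C1.
- by rewrite /segment_curve scale0r addr0.
- by rewrite /segment_curve scale1r addrC subrK.
Qed.

Lemma gm_dist_le_segment (R : realType) n (Mt : R -> 'M[R]_n) (B : R)
    (p q : gm_carrier R n) : continuous Mt ->
  (forall u, u \in `[0, 1] -> gm_norm Mt (segment_curve p q u) (q - p) <= B) ->
  gm_dist Mt p q <= B.
Proof.
move=> cM HB; apply: (@le_trans _ _ (gm_length Mt (segment_curve p q))).
  have [_ lb] := gm_lengths_has_inf Mt p q.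
  apply: (ge_inf lb); exists (segment_curve p q) => //; split.
  - exact: segment_piecewise_C1.
  - by rewrite /segment_curve scale0r addr0.
  - by rewrite /segment_curve scale1r addrC subrK.
have C1g : C1 (segment_curve p q : R -> 'cV[R]_n * R) by exact: line_C1.
have [iab _] := @gm_speed_piece R n Mt 0 1 _ _ cM C1g (fun _ _ => erefl).
have m01 : measurable (`[0, 1]%classic : set R) by [].
have intB : \int[@lebesgue_measure R]_(x in `[0, 1]) B = B.
  have leb : lebesgue_measure (`[0, 1]%classic : set R) = 1%E.
    by rewrite lebesgue_measure_itv /= lte_fin ltr01 sube0.
  rewrite Rintegral_cst// -[RHS]mulr1; congr (_ * _).
  exact: (congr1 fine leb).
have iB : (@lebesgue_measure R).-integrable `[0, 1] (EFin \o (fun=> B)).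
  apply: continuous_compact_integrable; first exact: segment_compact.
  by apply: continuous_subspaceT => x; exact: cvg_cst.
apply: (@le_trans _ _ (\int[@lebesgue_measure R]_(x in `[0, 1]) B)).
  refine (@le_Rintegral _ _ R (@lebesgue_measure R) _ _ (fun=> B) m01 iab iB _) => x x01.
  rewrite /gm_speed; have [_ ->] := line_derivative p (q - p) x.
  exact: HB.
by rewrite intB.
Qed.

Lemma gm_dist_lt_curve (R : realType) n (Mt : R -> 'M[R]_n) (D : R)
    (p q : gm_carrier R n) : gm_dist Mt p q < D ->
  exists c : R -> 'cV[R]_n * R,
    [/\ piecewise_C1 0 1 c, c 0 = p, c 1 = q & gm_length Mt c < D].
Proof.
move=> pqD; have eps0 : 0 < D - gm_dist Mt p q by rewrite subr_gt0.
have [_ [c [c1 c2 c3] <-]] := inf_adherent eps0 (gm_lengths_has_inf Mt p q).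
by rewrite -/(gm_dist Mt p q) addrC subrK => cD; exists c.
Qed.

(** Along the straight segment the height stays within D of p, so the norms at
    different heights are comparable. *)
Lemma gm_dist_bounded_of_coord (R : realType) n (Mt : R -> 'M[R]_n) (D : R) :
  one_param_subgroup Mt -> 0 <= D ->
  exists2 B : R, 0 <= B & forall p q : gm_carrier R n,
    `|p.2 - q.2| <= D -> `|Mt (- p.2) *m (p.1 - q.1)| <= D ->
    gm_dist Mt p q <= B.
Proof.
move=> hM D0; have [E E0 EP] := one_param_bounded hM D0.
have [cM _ _] := hM.
exists (n%:R * (E * D) + D) => [|p q h2 h1].
  by rewrite addr_ge0// !mulr_ge0.
apply: gm_dist_le_segment => // u; rewrite in_itv /= => /andP[u0 u1].
apply: le_trans (gm_norm_le _ _ _) _ => /=.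
rewrite lerD//; last by rewrite distrC.
rewrite ler_wpM2l// (one_param_factor _ (- p.2))//.
apply: le_trans (EP _ _ _) _; last first.
  by rewrite ler_wpM2l// -normrN -mulmxN opprB.
have -> : - (segment_curve p q u).2 - - p.2 = u * (p.2 - q.2).
  rewrite /segment_curve /=; change (u *: (q.2 - p.2)) with (u * (q.2 - p.2)).
  by ring.
by rewrite normrM (ger0_norm u0) (le_trans _ h2)// ler_piMl.
Qed.

(** A curve of length < D stays within height D of its origin, where the metric
    controls the norm at p up to a constant. *)
Lemma coord_bounded_of_gm_dist (R : realType) n (Mt : R -> 'M[R]_n) (D : R) :
  one_param_subgroup Mt -> 0 <= D ->
  exists2 B : R, 0 <= B & forall p q : gm_carrier R n,
    gm_dist Mt p q < D ->
    `|p.2 - q.2| <= D /\ `|Mt (- p.2) *m (p.1 - q.1)| <= B.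
Proof.
move=> hM D0; have [E E0 EP] := one_param_bounded hM D0.
have [cM _ _] := hM; exists (E * D) => [|p q pqD]; first by rewrite mulr_ge0.
have [c [cC c0 c1 cD]] := gm_dist_lt_curve pqD.
have csnd : continuous (snd : 'cV[R]_n * R -> R) by move=> x; exact: cvg_snd.
have heights u : u \in `[0, 1] -> `|(c u).2 - p.2| <= D.
  move=> u01; rewrite -c0; apply: le_trans (ltW cD); rewrite -[leRHS]mul1r.
  apply: (displacement_le_length cM cC _ csnd) => // u' v _.
  by rewrite mul1r gm_norm_ge_vertical.
have u1 : (1 : R) \in `[0, 1] by rewrite in_itv /= ler01 lexx.
split; first by rewrite distrC -c1; exact: heights.
apply/mx_norm_leP => [|i j]; first by rewrite mulr_ge0.
rewrite (ord1 j).
pose psi (x : 'cV[R]_n * R) : R := (Mt (- p.2) *m x.1) i 0.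
have lpsi a x y : psi (a *: x + y) = a * psi x + psi y.
  by rewrite /psi /= mulmxDr -scalemxAr mxE [X in X + _]mxE.
have cpsi : continuous psi.
  have -> : psi = (fun x => \sum_k Mt (- p.2) i k * x.1 k 0).
    by apply/funext => x; rewrite /psi mxE.
  move=> x; apply: cvg_big => [|k _]; first exact: add_continuous.
  apply: cvgM; first exact: cvg_cst.
  have cf : z.1 @[z --> x] --> x.1 by exact: cvg_fst.
  exact: (cvg_comp _ _ cf (@coord_continuous _ _ _ k 0 _)).
have psiE u v : u \in `[0, 1] -> `|psi v| <= E * gm_norm Mt (c u) v.
  move=> u01; apply: le_trans (ler_entry_norm _ _ _) _.
  rewrite (one_param_factor _ (- (c u).2))//.
  apply: le_trans (EP _ _ _) _; last by rewrite ler_wpM2l// gm_norm_ge_horizontal.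
  by rewrite opprK addrC; exact: heights.
have := displacement_le_length cM cC lpsi cpsi E0 psiE u1.
rewrite c0 c1 distrC => h; apply: le_trans (le_trans h _); last first.
  by rewrite ler_wpM2l// ltW.
by rewrite /psi mulmxBr !mxE.
Qed.

(** * The maps between horizontal leaves *)

Lemma set_dist_lt (R : realType) (X : Type) (d : X -> X -> R) (x : X) (S : set X)
    (r : R) : (set_dist d x S <= r%:E)%E -> exists2 a, S a & d x a < r + 1.
Proof.
move=> le_r; have : (set_dist d x S < (r + 1)%:E)%E.
  by apply: le_lt_trans le_r _; rewrite lte_fin ltrDl.
move=> /ereal_inf_lt[_ [a Sa <-]]; rewrite lte_fin => xa.
by exists a.
Qed.

Lemma hausdorff_dist_leP (R : realType) (X : Type) (d : X -> X -> R) (S T : set X)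
    (r : R) : (hausdorff_dist d S T <= r%:E)%E ->
  (forall a, S a -> exists2 b, T b & d a b < r + 1) /\
  (forall b, T b -> exists2 a, S a & d b a < r + 1).
Proof.
rewrite /hausdorff_dist ge_max => /andP[le1 le2]; split=> a aS.
  apply: set_dist_lt; apply: le_trans le1; apply: ereal_sup_ubound.
  by exists a.
apply: set_dist_lt; apply: le_trans le2; apply: ereal_sup_ubound.
by exists a.
Qed.

(** Subdivide the segment from x' to x into steps of S-size at most 1. *)
Lemma coarse_lipschitz_of_unit_steps (R : realType) n (S T : 'M[R]_n)
    (g : 'cV[R]_n -> 'cV[R]_n) (C : R) : 0 <= C ->
  (forall x x', `|S *m (x - x')| <= 1 -> `|T *m (g x - g x')| <= C) ->
  forall x x', `|T *m (g x - g x')| <= C * (`|S *m (x - x')| + 1).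
Proof.
move=> C0 step x x'; set r := `|S *m (x - x')|.
pose m := (Num.truncn r).+1.
have m0 : 0 < m%:R :> R by rewrite ltr0n.
pose pt (i : nat) := x' + (i%:R / m%:R) *: (x - x').
have chain i : `|T *m (g (pt i) - g x')| <= C * i%:R.
  elim: i => [|i IHi].
    by rewrite /pt mul0r scale0r addr0 subrr mulmx0 normr0 mulr0.
  rewrite -(subrK (g (pt i)) (g (pt i.+1))) -addrA mulmxDr.
  apply: le_trans (ler_normD _ _) _; rewrite -natr1 mulrDr mulr1 [leRHS]addrC lerD//.
  apply: step; rewrite /pt opprD addrACA subrr add0r -scalerBl -mulrBl -natr1.
  rewrite addrAC subrr add0r div1r -scalemxAr normrZ ger0_norm ?invr_ge0 ?ler0n//.
  by rewrite ler_pdivrMl// mulr1 -/r ltW// truncnS_gt.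
have ptm : pt m = x by rewrite /pt divff ?gt_eqF// scale1r addrC subrK.
have := chain m; rewrite ptm =>  /le_trans; apply; rewrite ler_wpM2l// /m -natr1 lerD2r.
by rewrite truncn_le normr_ge0.
Qed.

Lemma one_param_norm_le (R : realType) n (Mt : R -> 'M[R]_n) (D : R) :
  one_param_subgroup Mt -> 0 <= D ->
  exists2 E : R, 0 <= E & forall s t (x : 'cV[R]_n), `|s - t| <= D ->
    `|Mt s *m x| <= E * `|Mt t *m x|.
Proof.
move=> hM D0; have [E E0 EP] := one_param_bounded hM D0.
by exists E => // s t x st; rewrite (one_param_factor s t)//; exact: EP.
Qed.

(** The bound on the Hausdorff distance in coordinates: phi keeps each leaf
    within height H of its target, and is coarsely onto the target leaf. *)
Lemma leaf_heights (R : realType) n (Nt : R -> 'M[R]_n)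
    (phi : gm_carrier R n -> gm_carrier R n) (h : R -> R) (A : R) :
  one_param_subgroup Nt -> 0 <= A ->
  (forall t, (hausdorff_dist (gm_dist Nt) (phi @` gm_leaf n t)%classic
    (gm_leaf n (h t)) <= A%:E)%E) ->
  exists2 H : R, 0 <= H &
    (forall t x, `|(phi (x, t)).2 - h t| <= H) /\
    (forall t y, exists x, `|Nt (- h t) *m (y - (phi (x, t)).1)| <= H).
Proof.
move=> hN A0 hA; have A10 : 0 <= A + 1 by rewrite addr_ge0.
have [B B0 BP] := coord_bounded_of_gm_dist hN A10.
exists (A + 1 + B); first by rewrite addr_ge0.
split=> t x.
  have [/(_ (phi (x, t)))[|a /= ah /BP[d2 _] _]] := hausdorff_dist_leP (hA t).
    by exists (x, t).
  by rewrite -ah (le_trans d2)// lerDl.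
have [_ /(_ (x, h t))[//|_ [[x' s] st <-]]] := hausdorff_dist_leP (hA t).
rewrite /gm_leaf /= in st; rewrite st => /BP[_ d1]; exists x'; rewrite (le_trans d1)// lerDr//.
Qed.

(** At heights within H of h(t), distance in G_N and the norm at height h(t)
    bound each other, so this is the quasi-isometry inequality in coordinates. *)
Lemma leaf_map_proper (R : realType) n (Mt Nt : R -> 'M[R]_n)
    (phi : gm_carrier R n -> gm_carrier R n) (h : R -> R) (H K C : R) :
  one_param_subgroup Mt -> one_param_subgroup Nt -> 0 <= H ->
  (forall t x, `|(phi (x, t)).2 - h t| <= H) ->
  quasi_isometry_with (gm_dist Mt) (gm_dist Nt) K C phi ->
  forall D, 0 <= D -> exists2 B : R, 0 <= B & forall t x x',
   (`|Mt (- t) *m (x - x')| <= D ->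
    `|Nt (- h t) *m ((phi (x, t)).1 - (phi (x', t)).1)| <= B) /\
   (`|Nt (- h t) *m ((phi (x, t)).1 - (phi (x', t)).1)| <= D ->
    `|Mt (- t) *m (x - x')| <= B).
Proof.
move=> hM hN H0 hH [K1 C0 qi _] D D0.
have K0 : 0 < K by exact: lt_le_trans K1.
have [E E0 EP] := one_param_norm_le hN H0.
have [B1 B10 B1P] := gm_dist_bounded_of_coord hM D0.
have D10 : 0 <= K * B1 + C + 1 by rewrite !addr_ge0// mulr_ge0// ltW.
have [B2 B20 B2P] := coord_bounded_of_gm_dist hN D10.
have D20 : 0 <= 2 * H + E * D by rewrite addr_ge0// mulr_ge0.
have [B3 B30 B3P] := gm_dist_bounded_of_coord hN D20.
have D30 : 0 <= K * (B3 + C) + 1.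
  by rewrite addr_ge0// mulr_ge0 ?addr_ge0// ltW.
have [B4 B40 B4P] := coord_bounded_of_gm_dist hM D30.
exists (E * B2 + B4) => [|t x x']; first by rewrite addr_ge0// mulr_ge0.
have Et (s : R) (y : 'cV[R]_n) : `|s - h t| <= H ->
    `|Nt (- s) *m y| <= E * `|Nt (- h t) *m y| /\
    `|Nt (- h t) *m y| <= E * `|Nt (- s) *m y|.
  by move=> st; split; apply: EP; rewrite opprK addrC// distrC.
split=> small.
  have dM : gm_dist Mt (x, t) (x', t) <= B1.
    by apply: B1P => //=; rewrite subrr normr0.
  have /B2P[_ d1] : gm_dist Nt (phi (x, t)) (phi (x', t)) < K * B1 + C + 1.
    have /andP[_ /le_lt_trans] := qi (x, t) (x', t); apply.
    by rewrite ltr_pwDr// lerD2r ler_pM2l.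
  have [_ /le_trans] := Et _ ((phi (x, t)).1 - (phi (x', t)).1) (hH t x); apply.
  by rewrite (@le_trans _ _ (E * B2)) ?lerDl// ler_wpM2l.
have dN : gm_dist Nt (phi (x, t)) (phi (x', t)) <= B3.
  apply: B3P => //.
    have -> : (phi (x, t)).2 - (phi (x', t)).2 =
       ((phi (x, t)).2 - h t) - ((phi (x', t)).2 - h t) by ring.
    rewrite (le_trans (ler_normB _ _))//.
    have := hH t x; have := hH t x'; have : 0 <= E * D by rewrite mulr_ge0.
    lra.
  have [/le_trans + _] := Et _ ((phi (x, t)).1 - (phi (x', t)).1) (hH t x).
  apply; apply: (@le_trans _ _ (E * D)); first by rewrite ler_wpM2l.
  by rewrite lerDr mulr_ge0.
have /B4P[_] : gm_dist Mt (x, t) (x', t) < K * (B3 + C) + 1.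
  have /andP[+ _] := qi (x, t) (x', t).
  rewrite lerBlDr ler_pdivrMl// => /le_lt_trans; apply.
  by rewrite ltr_pwDr// ler_pM2l// lerD2r.
by move=> /= /le_trans; apply; rewrite lerDr mulr_ge0.
Qed.

Lemma leaf_map_time_shift (R : realType) n (Mt Nt : R -> 'M[R]_n)
    (phi : gm_carrier R n -> gm_carrier R n) (h : R -> R) (H K C : R) :
  one_param_subgroup Mt -> one_param_subgroup Nt -> 0 <= H ->
  (forall t x, `|(phi (x, t)).2 - h t| <= H) ->
  quasi_isometry_with (gm_dist Mt) (gm_dist Nt) K C phi ->
  forall t, exists2 E : R, 0 <= E & forall x,
   `|(phi (x, t)).1 - (phi (x, 0)).1| <= E.
Proof.
move=> hM hN H0 hH [K1 C0 qi _] t.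
have K0 : 0 < K by exact: lt_le_trans K1.
have [B1 B10 B1P] := gm_dist_bounded_of_coord hM (normr_ge0 t).
have D10 : 0 <= K * B1 + C + 1 by rewrite !addr_ge0// mulr_ge0// ltW.
have [B2 B20 B2P] := coord_bounded_of_gm_dist hN D10.
have D20 : 0 <= H + `|h t| by rewrite addr_ge0.
have [E E0 EP] := one_param_norm_le hN D20.
exists (E * B2) => [|x]; first by rewrite mulr_ge0.
have dM : gm_dist Mt (x, t) (x, 0) <= B1.
  by apply: B1P; [rewrite /= subr0|rewrite /= subrr mulmx0 normr0].
have /B2P[_ d1] : gm_dist Nt (phi (x, t)) (phi (x, 0)) < K * B1 + C + 1.
  have /andP[_ /le_lt_trans] := qi (x, t) (x, 0); apply.
  by rewrite ltr_pwDr// lerD2r ler_pM2l.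
set y := _ - _ in d1 *.
have -> : y = Nt 0 *m y by rewrite one_param_subgroup0// mul1mx.
apply: le_trans (EP 0 (- (phi (x, t)).2) y _) _; last by rewrite ler_wpM2l.
rewrite sub0r opprK -(subrK (h t) (phi (x, t)).2).
by rewrite (le_trans (ler_normD _ _))// lerD.
Qed.

(** The factor K serves all heights at once; only the additive error depends on
    t. The reverse inequality comes from a coarse inverse g of f_t, which also
    moves unit steps by bounded amounts. *)
Lemma coarse_leaf_map (R : realType) n (Mt Nt : R -> 'M[R]_n)
    (phi : gm_carrier R n -> gm_carrier R n) :
  one_param_subgroup Mt -> one_param_subgroup Nt ->
  quasi_isometry (gm_dist Mt) (gm_dist Nt) phi ->
  horizontal_respecting Nt phi ->
  exists (f : 'cV[R]_n -> 'cV[R]_n) (h : R -> R) (K : R),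
  [/\ 0 < K,
     (forall t, exists2 E : R, 0 <= E & forall x x',
       `|Nt (- h t) *m (f x - f x')| <= K * `|Mt (- t) *m (x - x')| + E /\
       `|Mt (- t) *m (x - x')| <= K * `|Nt (- h t) *m (f x - f x')| + E) &
     (exists2 E : R, 0 <= E & forall y, exists x, `|y - f x| <= E)].
Proof.
move=> hM hN [K [C qi]] [h [A [A0 hA]]].
have [H H0 [hH hsurj]] := leaf_heights hN A0 hA.
have proper := leaf_map_proper hM hN H0 hH qi.
pose f t x := (phi (x, t)).1.
have [C1 C10 C1P] := proper 1 ler01.
have H10 : 0 <= 1 + 2 * H by rewrite addr_ge0// mulr_ge0.
have [C2 C20 C2P] := proper _ H10.
have [C3 C30 C3P] := proper _ H0.
have fwd t := @coarse_lipschitz_of_unit_steps _ _ (Mt (- t)) (Nt (- h t)) (f t) _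
  C10 (fun x x' => (C1P t x x').1).
have bwd t x x' : `|Mt (- t) *m (x - x')| <=
    C2 * (`|Nt (- h t) *m (f t x - f t x')| + 1) + 2 * C3.
  have [g gP] := choice (hsurj t).
  have gstep y y' : `|Nt (- h t) *m (y - y')| <= 1 ->
      `|Mt (- t) *m (g y - g y')| <= C2.
    move=> yy'; apply: (C2P t (g y) (g y')).2; rewrite -/(f t (g y)) -/(f t (g y')).
    have -> : f t (g y) - f t (g y') =
        (y - y') + ((y' - f t (g y')) - (y - f t (g y))).
      by apply/matrixP => i j; rewrite !mxE; ring.
    rewrite mulmxDr (le_trans (ler_normD _ _))// lerD//.
    rewrite mulmxBr (le_trans (ler_normB _ _))// mulr_natl mulr2n lerD//; exact: gP.
  have gf z : `|Mt (- t) *m (z - g (f t z))| <= C3.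
    by apply: (C3P t z (g (f t z))).2; exact: gP.
  have -> : x - x' = (g (f t x) - g (f t x')) +
      ((x - g (f t x)) - (x' - g (f t x'))).
    by apply/matrixP => i j; rewrite !mxE; ring.
  rewrite mulmxDr (le_trans (ler_normD _ _))// lerD//.
    exact: (coarse_lipschitz_of_unit_steps C20 gstep).
  by rewrite mulmxBr (le_trans (ler_normB _ _))// mulr_natl mulr2n lerD// gf.
exists (f 0), h, (C1 + C2 + 1); split.
- by rewrite ltr_wpDl// addr_ge0.
- move=> t; have [E E0 EP] := leaf_map_time_shift hM hN H0 hH qi t.
  pose c := n%:R * `|Nt (- h t)|; have c0 : 0 <= c by rewrite mulr_ge0.
  have shift x x' : `|Nt (- h t) *m ((f t x - f t x') - (f 0 x - f 0 x'))| <=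
      c * (2 * E).
    apply: le_trans (mulmx_norm_le _ _) _; rewrite ler_wpM2l//.
    have -> : f t x - f t x' - (f 0 x - f 0 x') =
       (f t x - f 0 x) - (f t x' - f 0 x').
      by apply/matrixP => i j; rewrite !mxE; ring.
    by rewrite (le_trans (ler_normB _ _))// mulr_natl mulr2n lerD// EP.
  exists (C1 + C2 + 2 * C3 + (1 + C2) * (c * (2 * E))).
    by rewrite !addr_ge0 ?mulr_ge0 ?addr_ge0.
  move=> x x'; have := shift x x'; have := fwd t x x'; have := bwd t x x'.
  set w := f t x - f t x'; set w0 := f 0 x - f 0 x'; set m := `|Mt _ *m _|.
  set a := `|Nt _ *m w|; set b := `|Nt _ *m w0|; rewrite mulmxBr => h1 h2 h3.
  have ab : a <= b + c * (2 * E).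
    rewrite /a -(subrK (Nt (- h t) *m w0) (Nt (- h t) *m w)) addrC.
    by rewrite (le_trans (ler_normD _ _))// lerD.
  have ba : b <= a + c * (2 * E).
    rewrite /b -(subrK (Nt (- h t) *m w) (Nt (- h t) *m w0)) addrC.
    by rewrite (le_trans (ler_normD _ _))// lerD// distrC.
  have [m0 a0 b0] : [/\ 0 <= m, 0 <= a & 0 <= b] by split; exact: normr_ge0.
  have e0 : 0 <= c * (2 * E) by rewrite !mulr_ge0.
  have ? : 0 <= C2 * m by rewrite mulr_ge0.
  have ? : 0 <= C1 * b by rewrite mulr_ge0.
  have ? : 0 <= C2 * (c * (2 * E)) by rewrite mulr_ge0.
  have ? : C2 * a <= C2 * (b + c * (2 * E)) by rewrite ler_wpM2l.
  by split; lra.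
have [E E0 EP] := one_param_norm_le hN (normr_ge0 (h 0)).
exists (E * H) => [|y]; first by rewrite mulr_ge0.
have [x xy] := hsurj 0 y; exists x.
have -> : y - f 0 x = Nt 0 *m (y - f 0 x) by rewrite one_param_subgroup0// mul1mx.
apply: le_trans (EP 0 (- h 0) _ _) _; first by rewrite sub0r opprK.
by rewrite ler_wpM2l.
Qed.

(** * Passing to the asymptotic cone *)

(** An ultrafilter decides whether the sequence is near a cluster point. *)
Lemma ultralimit_real (R : realType) (U : set_system nat) (u : nat -> R) (b : R) :
  UltraFilter U -> (forall k, `|u k| <= b) ->
  exists l, forall eps, 0 < eps -> U [set k | `|u k - l| <= eps].
Proof.
move=> UU ub.
have Uab : (u @ U) `[- b, b]%classic.
  suff : U [set k | u k \in `[- b, b]] by [].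
  by apply: filterE => k; rewrite /= in_itv /= -ler_norml; exact: ub.
have [l [_ cl]] := @segment_compact R (- b) b _ _ Uab.
exists l => eps eps0.
have [//|Uc] := in_ultra_setVsetC [set k | `|u k - l| <= eps] UU.
have Uc' : (u @ U) [set x | ~ (`|x - l| <= eps)] by [].
have [x [/= h1]] := cl _ _ Uc' (nbhsx_ballx l eps eps0).
by rewrite -ball_normE /= distrC => /ltW.
Qed.

Lemma ultralimit_col (R : realType) (U : set_system nat) n (u : nat -> 'cV[R]_n)
    (b : R) : UltraFilter U -> (forall k, `|u k| <= b) ->
  exists l, forall eps, 0 < eps -> U [set k | `|u k - l| <= eps].
Proof.
move=> UU ub.
have /choice[l lP] : forall i, exists l, forall eps, 0 < eps ->
    U [set k | `|u k i 0 - l| <= eps].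
  move=> i; apply: ultralimit_real => k.
  exact: le_trans (ler_entry_norm _ _ _) (ub k).
exists (\col_i l i) => eps eps0.
have : \forall k \near U, forall i, `|u k i 0 - l i| <= eps.
  by apply: filter_forall => i; exact: lP.
apply: filterS => k H; apply/mx_norm_leP => [|i j]; first exact: ltW.
by rewrite !mxE (ord1 j).
Qed.

Lemma le_of_eps (R : realType) (a b D : R) : 0 <= D ->
  (forall eps, 0 < eps -> a <= b + D * eps) -> a <= b.
Proof.
move=> D0 H; apply/ler_addgt0Pr => e e0.
have D1 : 0 < D + 1 by rewrite ltr_wpDl.
apply: le_trans (H (e / (D + 1)) _) _; first by rewrite divr_gt0.
rewrite lerD2l mulrA ler_pdivrMr// mulrC ler_pM2l//.
by rewrite lerDl.
Qed.

(** F x is the limit of f(k x) / k along an ultrafilter containing the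
    cofinite sets. Given finitely many points and eps, some k makes these
    quotients eps-close to their limits and E / k smaller than eps, so the
    inequalities pass to the limit. The matrices T i and S i stand for the
    norms at the height i. Surjectivity: coarse preimages x_k of k y give a
    bounded sequence x_k / k, whose limit is a preimage of y. *)
Lemma scaling_limit (R : realType) n (f : 'cV[R]_n -> 'cV[R]_n) (K : R)
    (I : Type) (S T : I -> 'M[R]_n) (i0 : I) :
  0 < K -> S i0 \in unitmx -> T i0 \in unitmx ->
  (forall i, exists2 E : R, 0 <= E & forall x x',
       `|T i *m (f x - f x')| <= K * `|S i *m (x - x')| + E /\
       `|S i *m (x - x')| <= K * `|T i *m (f x - f x')| + E) ->
  (exists2 E : R, 0 <= E & forall y, exists x, `|y - f x| <= E) ->
  exists F G : 'cV[R]_n -> 'cV[R]_n, cancel G F /\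
    forall i x x',
       `|T i *m (F x - F x')| <= K * `|S i *m (x - x')| /\
       `|S i *m (x - x')| <= K * `|T i *m (F x - F x')|.
Proof.
move=> K0 Su Tu fP [E1 E10 fsurj].
have [U [UU Uoo]] := ultraFilterLemma (eventually_filter : ProperFilter \oo).
have Uinv eps : 0 < eps -> U [set k | k.+1%:R^-1 <= eps :> R].
  move=> eps0; apply: Uoo; exists (Num.truncn eps^-1) => // k /= hk.
  rewrite -[eps]invrK lef_pV2 ?posrE ?invr_gt0 ?ltr0n//.
  by apply: ltW; apply: lt_le_trans (truncnS_gt _) _; rewrite ler_nat ltnS.
have [L L0 [E E0 fL]] : exists2 L : R, 0 < L & exists2 E : R, 0 <= E & forall x x',
    `|f x - f x'| <= L * `|x - x'| + E /\ `|x - x'| <= L * `|f x - f x'| + E.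
  have [E E0 EP] := fP i0.
  have inv_le (A : 'M[R]_n) (x : 'cV[R]_n) : A \in unitmx ->
      `|x| <= n%:R * `|invmx A| * `|A *m x|.
    by move=> Au; rewrite -{1}(mulKmx Au x) mulmx_norm_le.
  (* The norms at the index i0 are equivalent to the standard one. *)
  pose a := n%:R * `|invmx (S i0)|; pose b := n%:R * `|invmx (T i0)|.
  pose a' := n%:R * `|S i0|; pose b' := n%:R * `|T i0|.
  have [a0 b0 a'0 b'0] : [/\ 0 <= a, 0 <= b, 0 <= a' & 0 <= b'].
    by split; rewrite mulr_ge0.
  exists (b * (K * a') + a * (K * b') + 1).
    by rewrite ltr_wpDl// addr_ge0// !mulr_ge0// ltW.
  exists ((a + b) * E) => [|x x']; first by rewrite mulr_ge0// addr_ge0.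
  have [h1 h2] := EP x x'.
  have xx0 : 0 <= `|x - x'| by [].
  have ff0 : 0 <= `|f x - f x'| by [].
  have aKb : 0 <= a * (K * b') by rewrite !mulr_ge0// ltW.
  have bKa : 0 <= b * (K * a') by rewrite !mulr_ge0// ltW.
  split.
    apply: le_trans (inv_le _ _ Tu) _; rewrite -/b.
    have : b * `|T i0 *m (f x - f x')| <= b * (K * (a' * `|x - x'|) + E).
      rewrite ler_wpM2l// (le_trans h1)// lerD2r ler_pM2l//.
      exact: mulmx_norm_le.
    have : 0 <= a * (K * b') * `|x - x'| by rewrite mulr_ge0.
    have : 0 <= a * E by rewrite mulr_ge0.
    by rewrite !mulrDr !mulrDl mul1r !mulrA; lra.
  apply: le_trans (inv_le _ _ Su) _; rewrite -/a.
  have : a * `|S i0 *m (x - x')| <= a * (K * (b' * `|f x - f x'|) + E).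
    rewrite ler_wpM2l// (le_trans h2)// lerD2r ler_pM2l//.
    exact: mulmx_norm_le.
  have : 0 <= b * (K * a') * `|f x - f x'| by rewrite mulr_ge0.
  have : 0 <= b * E by rewrite mulr_ge0.
  by rewrite !mulrDr !mulrDl mul1r !mulrA; lra.
(* k + 1 avoids the division by zero at k = 0. *)
have [fk fkE] : exists fk : nat -> 'cV[R]_n -> 'cV[R]_n,
    forall k x, fk k x = k.+1%:R^-1 *: f (k.+1%:R *: x).
  by exists (fun k x => k.+1%:R^-1 *: f (k.+1%:R *: x)).
have k0 (k : nat) : 0 < k.+1%:R :> R by rewrite ltr0n.
have kV0 (k : nat) : 0 <= k.+1%:R^-1 :> R by rewrite invr_ge0.
have kV1 (k : nat) : k.+1%:R^-1 <= 1 :> R by rewrite invf_le1// ler1n.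
have fk_bounded x k : `|fk k x| <= L * `|x| + E + `|f 0|.
  rewrite fkE normrZ ger0_norm// ler_pdivrMl//.
  rewrite -(subrK (f 0) (f _)) (le_trans (ler_normD _ _))//.
  have [h _] := fL (k.+1%:R *: x) 0; rewrite subr0 normrZ ger0_norm// in h.
  have k1 : 1 <= k.+1%:R :> R by rewrite ler1n.
  have : E <= k.+1%:R * E by rewrite ler_peMl.
  have : `|f 0| <= k.+1%:R * `|f 0| by rewrite ler_peMl.
  by rewrite !mulrDr [_ * (L * _)]mulrCA; lra.
have /choice[F FP] : forall x, exists l, forall eps, 0 < eps ->
    U [set k | `|fk k x - l| <= eps].
  by move=> x; apply: ultralimit_col (fk_bounded x).
have Fineq i x x' :
    `|T i *m (F x - F x')| <= K * `|S i *m (x - x')| /\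
    `|S i *m (x - x')| <= K * `|T i *m (F x - F x')|.
  have [Ei Ei0 EiP] := fP i.
  pose c := n%:R * `|T i|; have c0 : 0 <= c by rewrite mulr_ge0.
  have key eps : 0 < eps ->
      `|T i *m (F x - F x')| <= K * `|S i *m (x - x')| + (Ei + c * 2) * eps /\
      `|S i *m (x - x')| <= K * `|T i *m (F x - F x')| + (K * (c * 2) + Ei) * eps.
    move=> eps0.
    have [k [[/= hx hx'] hk]] :=
      filter_ex (filterI (filterI (FP x eps eps0) (FP x' eps eps0)) (Uinv _ eps0)).
    have [h1 h2] := EiP (k.+1%:R *: x) (k.+1%:R *: x').
    have fdE : f (k.+1%:R *: x) - f (k.+1%:R *: x') =
        k.+1%:R *: (fk k x - fk k x').
      by rewrite !fkE scalerBr !scalerA divff ?scale1r// gt_eqF.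
    rewrite fdE -scalerBr -!scalemxAr !normrZ !ger0_norm// in h1 h2.
    set p := `|T i *m (fk k x - fk k x')| in h1 h2.
    set q := `|S i *m (x - x')| in h1 h2 *.
    have h1' : p <= K * q + Ei * eps.
      have : p <= K * q + Ei * k.+1%:R^-1.
        rewrite -(@ler_pM2l _ k.+1%:R)// mulrDr (le_trans h1)//.
        by rewrite mulrCA [_ * (Ei * _)]mulrCA divff ?mulr1// gt_eqF.
      by move=> /le_trans; apply; rewrite lerD2l ler_wpM2l.
    have h2' : q <= K * p + Ei * eps.
      have : q <= K * p + Ei * k.+1%:R^-1.
        rewrite -(@ler_pM2l _ k.+1%:R)// mulrDr (le_trans h2)//.
        by rewrite mulrCA [_ * (Ei * _)]mulrCA divff ?mulr1// gt_eqF.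
      by move=> /le_trans; apply; rewrite lerD2l ler_wpM2l.
    have diff : `|T i *m (fk k x - fk k x') - T i *m (F x - F x')| <= c * 2 * eps.
      rewrite -mulmxBr -mulrA; apply: le_trans (mulmx_norm_le _ _) _.
      rewrite ler_wpM2l//.
      have -> : fk k x - fk k x' - (F x - F x') = (fk k x - F x) - (fk k x' - F x').
        by apply/matrixP => a b; rewrite !mxE; ring.
      by rewrite (le_trans (ler_normB _ _))// mulr_natl mulr2n lerD.
    set r := `|T i *m (F x - F x')|.
    have rp : r <= p + c * 2 * eps.
      rewrite /r -(subrK (T i *m (fk k x - fk k x')) (T i *m (F x - F x'))) addrC.
      by rewrite (le_trans (ler_normD _ _))// lerD// distrC.
    have pr : p <= r + c * 2 * eps.
      rewrite /p -(subrK (T i *m (F x - F x')) (T i *m (fk k x - fk k x'))) addrC.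
      by rewrite (le_trans (ler_normD _ _))// lerD.
    have Kp : K * p <= K * (r + c * 2 * eps) by rewrite ler_pM2l.
    by split; lra.
  split; [apply: (@le_of_eps _ _ _ (Ei + c * 2))|
          apply: (@le_of_eps _ _ _ (K * (c * 2) + Ei))].
  - by rewrite addr_ge0// mulr_ge0.
  - by move=> eps /key[].
  - by rewrite addr_ge0// !mulr_ge0// ltW.
  - by move=> eps /key[].
have Fsurj y : exists x, F x = y.
  have /choice[xk xkP] : forall k : nat, exists x, `|k.+1%:R *: y - f x| <= E1.
    by move=> k; exact: fsurj.
  have xk_bounded k : `|k.+1%:R^-1 *: xk k| <=
      L * (`|y| + E1 + `|f 0|) + E.
    rewrite normrZ ger0_norm// ler_pdivrMl//.
    have [_ h] := fL (xk k) 0; rewrite subr0 in h; apply: le_trans h _.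
    have k1 : 1 <= k.+1%:R :> R by rewrite ler1n.
    rewrite mulrDr lerD ?ler_peMl// mulrCA ler_pM2l//.
    have -> : f (xk k) - f 0 = k.+1%:R *: y - (k.+1%:R *: y - f (xk k)) - f 0.
      by rewrite opprB [_ + (f _ - _)]addrC subrK.
    rewrite (le_trans (ler_normB _ _))// !mulrDr lerD ?ler_peMl//.
    rewrite (le_trans (ler_normB _ _))// lerD//.
      by rewrite normrZ ger0_norm.
    by rewrite (le_trans (xkP k))// ler_peMl.
  have [x xP] := ultralimit_col UU xk_bounded.
  exists x; apply/eqP; rewrite -subr_eq0 -normr_le0.
  apply: (@le_of_eps _ _ _ (1 + L + E + E1)); first by rewrite !addr_ge0// ltW.
  move=> eps eps0; rewrite add0r.
  have [k [[/= hF hx] hk]] :=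
    filter_ex (filterI (filterI (FP x eps eps0) (xP eps eps0)) (Uinv _ eps0)).
  have -> : F x - y = - (fk k x - F x) +
      (k.+1%:R^-1 *: (f (k.+1%:R *: x) - f (xk k)) -
       k.+1%:R^-1 *: (k.+1%:R *: y - f (xk k))).
    rewrite !scalerBr -fkE scalerA mulVf ?gt_eqF// scale1r.
    by apply/matrixP => i j; rewrite !mxE; ring.
  have b1 : `|k.+1%:R^-1 *: (f (k.+1%:R *: x) - f (xk k))| <= L * eps + E * eps.
    rewrite normrZ ger0_norm//; have [h _] := fL (k.+1%:R *: x) (xk k).
    apply: le_trans (ler_wpM2l (kV0 k) h) _; rewrite mulrDr mulrCA.
    rewrite lerD//; last by rewrite mulrC ler_wpM2l.
    rewrite ler_pM2l// -[X in X * _]ger0_norm// -normrZ scalerBr scalerA.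
    by rewrite mulVf ?gt_eqF// scale1r distrC.
  have b2 : `|k.+1%:R^-1 *: (k.+1%:R *: y - f (xk k))| <= E1 * eps.
    by rewrite normrZ ger0_norm// mulrC ler_pM.
  rewrite (le_trans (ler_normD _ _))// normrN.
  have := ler_normB (k.+1%:R^-1 *: (f (k.+1%:R *: x) - f (xk k)))
       (k.+1%:R^-1 *: (k.+1%:R *: y - f (xk k))).
  by rewrite !mulrDl mul1r; lra.
have [G GP] := choice Fsurj.
by exists F, G.
Qed.

(** * Determinants along a one-parameter subgroup and the height change *)

(** g is periodic because it vanishes at the integers, hence bounded everywhere,
    and g (j s) = j g s. *)
Lemma additive_bounded_eq0 (R : realType) (g : R -> R) (b : R) :
  (forall s t, g (s + t) = g s + g t) -> g 1 = 0 ->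
  (forall s, 0 <= s <= 1 -> `|g s| <= b) -> forall s, g s = 0.
Proof.
move=> gD g1 gb.
have g0 : g 0 = 0 by have := gD 0 0; rewrite addr0 => h; lra.
have gN s : g (- s) = - g s.
  by have := gD s (- s); rewrite subrr g0 => h; lra.
have gMn s (m : nat) : g (m%:R * s) = m%:R * g s.
  elim: m => [|m IHm]; first by rewrite !mul0r.
  by rewrite -natr1 !mulrDl !mul1r gD IHm.
have gnat (m : nat) : g m%:R = 0 by have := gMn 1 m; rewrite mulr1 g1 mulr0.
have gint (m : int) : g m%:~R = 0.
  by case: m => m; [exact: gnat|rewrite NegzE mulrNz gN gnat oppr0].
have gall s : `|g s| <= b.
  rewrite -(subrK (Num.floor s)%:~R s) gD gint addr0; apply: gb.
  have := floor_itv s; rewrite intrD => /andP[h1 h2].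
  by apply/andP; split; lra.
move=> s; apply/eqP; rewrite -normr_le0.
apply: (@le0_of_bounded_multiples _ b) => j.
by have := gall (j.+1%:R * s); rewrite gMn normrM normr_nat.
Qed.

Lemma det_norm_le (R : realType) n (A : 'M[R]_n) (E : R) :
  (forall x : 'cV[R]_n, `|A *m x| <= E * `|x|) -> `|\det A| <= #|{perm 'I_n}|%:R * E ^+ n.
Proof.
move=> AE; apply: le_trans (ler_norm_sum _ _ _) _.
rewrite mulr_natl -sumr_const; apply: ler_sum => s _.
rewrite normrM normrX normrN1 expr1n mul1r normr_prod.
rewrite -[X in _ <= _ ^+ X]card_ord -prodr_const; apply: ler_prod => i _.
rewrite normr_ge0 /=; have := AE (delta_mx (s i) 0); rewrite -colE => h.
have := ler_entry_norm (col (s i) A) i 0; rewrite mxE => /le_trans.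
apply; apply: le_trans h _.
have -> : `|delta_mx (s i) 0 : 'cV[R]_n| = 1.
  apply/eqP; rewrite eq_le; apply/andP; split.
    apply/mx_norm_leP => // a b; rewrite mxE; case: (_ && _); by rewrite ?normr1 ?normr0.
  by have := ler_entry_norm (delta_mx (s i) 0 : 'cV[R]_n) (s i) 0; rewrite mxE !eqxx normr1.
by rewrite mulr1.
Qed.

Lemma one_param_det_gt0 (R : realType) n (Mt : R -> 'M[R]_n) (t : R) :
  one_param_subgroup Mt -> 0 < \det (Mt t).
Proof.
move=> [_ Mu MD]; have -> : t = t / 2 + t / 2 by field.
rewrite MD det_mulmx -expr2 lt0r sqr_ge0 andbT expf_eq0 /=.
by rewrite -unitfE -unitmxE.
Qed.

(** ln det is additive along the subgroup and bounded near 0, hence linear. *)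
Lemma ln_det_one_param (R : realType) n (Mt : R -> 'M[R]_n) (t : R) :
  one_param_subgroup Mt -> ln (\det (Mt t)) = t * ln (\det (Mt 1)).
Proof.
move=> hM; have det0 s := one_param_det_gt0 s hM; have [_ _ MD] := hM.
pose l s := ln (\det (Mt s)).
have lD s u : l (s + u) = l s + l u.
  by rewrite /l MD det_mulmx lnM// posrE.
have lN s : l (- s) = - l s.
  have l0 : l 0 = 0 by have := lD 0 0; rewrite addr0 => h; lra.
  by have := lD s (- s); rewrite subrr l0 => h; lra.
have [E E0 EP] := one_param_bounded hM ler01.
pose d := #|{perm 'I_n}|%:R * E ^+ n.
have lb s : `|s| <= 1 -> l s <= ln d.
  move=> s1; have := det_norm_le (fun x => EP s x s1).
  rewrite -/d gtr0_norm// => h; rewrite ler_ln ?posrE//.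
  exact: lt_le_trans h.
suff : l t - t * l 1 = 0 by rewrite /l => h; lra.
apply: (@additive_bounded_eq0 _ (fun t => l t - t * l 1) (`|ln d| + `|l 1|)) => [s u||s /andP[s0 s1]].
- by rewrite lD; ring.
- by ring.
have s1' : `|s| <= 1 by rewrite ger0_norm.
rewrite (le_trans (ler_normB _ _))// lerD//.
  rewrite ler_norml; apply/andP; split.
    rewrite -[l s]opprK -lN lerN2 (le_trans (lb (- s) _)) ?normrN// ler_norm//.
  by rewrite (le_trans (lb _ s1'))// ler_norm.
by rewrite normrM ler_piMl.
Qed.

Lemma one_param_exp (R : realType) n (Mt : R -> 'M[R]_n) (s : R) (j : nat) :
  one_param_subgroup Mt -> Mt s ^+ j = Mt (s * j%:R).
Proof.
move=> hM; have [_ _ MD] := hM; elim: j => [|j IHj].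
  by rewrite mulr0 one_param_subgroup0.
by rewrite exprS -mulmxE IHj -MD -natr1 mulrDr mulr1 addrC.
Qed.

(** The determinants of M^(-t) and N^(-h(t)) agree up to a factor independent
    of t; take logarithms. *)
Lemma height_change_affine (R : realType) n (Mt Nt : R -> 'M[R]_n)
    (F G : 'cV[R]_n -> 'cV[R]_n) (h : R -> R) (K : R) :
  one_param_subgroup Mt -> one_param_subgroup Nt -> 1 < \det (Nt 1) ->
  0 < K -> cancel G F ->
  (forall t x x',
     `|Nt (- h t) *m (F x - F x')| <= K * `|Mt (- t) *m (x - x')| /\
     `|Mt (- t) *m (x - x')| <= K * `|Nt (- h t) *m (F x - F x')|) ->
  exists2 D : R, 0 <= D & forall t,
    `|h t - ln (\det (Mt 1)) / ln (\det (Nt 1)) * t| <= D.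
Proof.
move=> hM hN detN K0 GK FP.
pose lM := ln (\det (Mt 1)); pose lN := ln (\det (Nt 1)).
have lN0 : 0 < lN by exact: ln_gt0.
pose K1 := K * (n%:R * `|Nt (- h 0)|) + K * (n%:R * `|invmx (Nt (- h 0))|) + K.
have c0 : 0 <= n%:R * `|Nt (- h 0)| by rewrite mulr_ge0.
have c'0 : 0 <= n%:R * `|invmx (Nt (- h 0))| by rewrite mulr_ge0.
have Kc0 : 0 <= K * (n%:R * `|Nt (- h 0)|) by rewrite mulr_ge0// ltW.
have Kc'0 : 0 <= K * (n%:R * `|invmx (Nt (- h 0))|) by rewrite mulr_ge0// ltW.
have K10 : 0 < K1 by rewrite ltr_wpDl// addr_ge0.
have KK1 : K <= K1 by rewrite lerDr addr_ge0.
have [_ Nu _] := hN; have [_ Mu _] := hM.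
have M0 (x : 'cV[R]_n) : Mt (- 0) *m x = x.
  by rewrite oppr0 one_param_subgroup0// mul1mx.
have exp1 x x' : `|x - x'| <= K1 * `|F x - F x'|.
  have [_] := FP 0 x x'; rewrite M0 => /le_trans; apply.
  apply: (@le_trans _ _ (K * (n%:R * `|Nt (- h 0)| * `|F x - F x'|))).
    by rewrite ler_pM2l// mulmx_norm_le.
  by rewrite mulrA ler_wpM2r// /K1 -addrA lerDl addr_ge0// ltW.
have exp2 y y' : `|y - y'| <= K1 * `|G y - G y'|.
  rewrite -{1}(GK y) -{1}(GK y'); have [+ _] := FP 0 (G y) (G y').
  rewrite M0 => le1; rewrite -[X in `|X|](mulKmx (Nu (- h 0))).
  apply: le_trans (mulmx_norm_le _ _) _.
  apply: (@le_trans _ _ (n%:R * `|invmx (Nt (- h 0))| * (K * `|G y - G y'|))).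
    by rewrite ler_wpM2l.
  by rewrite mulrA ler_wpM2r// [_ * K]mulrC /K1 addrAC lerDr addr_ge0// ltW.
have [C C0 HC] := @det_le_of_lipschitz R n K1 K10.
have lnle t s u v : one_param_subgroup u -> one_param_subgroup v ->
    `|\det (u s : 'M[R]_n)| <= C * `|\det (v t : 'M[R]_n)| ->
    s * ln (\det (u 1)) <= ln C + t * ln (\det (v 1)).
  move=> hu hv; have [us vt] := (one_param_det_gt0 s hu, one_param_det_gt0 t hv).
  rewrite !gtr0_norm// -!ln_det_one_param// => le1.
  by rewrite -lnM ?posrE// ler_ln// posrE// mulr_gt0.
have weaken (a b : R) : a <= K * b -> 0 <= b -> a <= K1 * b.
  by move=> /le_trans + b0; apply; rewrite ler_wpM2r.
have le1 t : - h t * lN <= ln C + - t * lM.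
  apply: lnle => //; apply: (HC _ _ F) => // x x'.
  by apply: weaken => //; have [] := FP t x x'.
have le2 t : - t * lM <= ln C + - h t * lN.
  apply: lnle => //; apply: (HC _ _ G) => // y y'.
  apply: weaken => //; have [_] := FP t (G y) (G y').
  by rewrite !GK.
exists (`|ln C| / lN) => [|t]; first by rewrite divr_ge0// ltW.
rewrite ler_pdivlMr// -[X in _ * X <= _](gtr0_norm lN0) -normrM.
have -> : (h t - lM / lN * t) * lN = h t * lN - t * lM by field; rewrite gt_eqF.
have := le1 t; have := le2 t; have := ler_norm (ln C) => h1 h2 h3.
by rewrite ler_norml; apply/andP; split; lra.
Qed.

Theorem theorem5 (R : realType) (n : nat) (Mt Nt : R -> 'M[R]_n)
    (hM : one_param_subgroup Mt) (hN : one_param_subgroup Nt)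
    (detM : 1 < \det (Mt 1)) (detN : 1 < \det (Nt 1)) :
  (exists phi : gm_carrier R n -> gm_carrier R n,
      quasi_isometry (gm_dist Mt) (gm_dist Nt) phi /\
      horizontal_respecting Nt phi) ->
  exists r s : R,
    [/\ 0 < r, 0 < s & same_absolute_jordan_form (Mt r) (Nt s)].
Proof.
move=> [phi [qi hr]].
have [f [h [K [K0 fP fsurj]]]] := coarse_leaf_map hM hN qi hr.
have [_ Mu _] := hM; have [_ Nu _] := hN.
have [F [G [GK FP]]] := @scaling_limit R n f K R (fun t => Mt (- t))
  (fun t => Nt (- h t)) 0 K0 (Mu _) (Nu _) fP fsurj.
have [D D0 hD] := height_change_affine hM hN detN K0 GK FP.
set m := ln _ / ln _ in hD.
have m0 : 0 < m by rewrite divr_gt0// ln_gt0.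
have [E E0 EP] := one_param_norm_le hN D0.
(* Nonnegative powers of M correspond to the leaves at height t = - j. *)
exists 1, m; split=> //.
have MtE (j : nat) : Mt 1 ^+ j = Mt (- (- j%:R)).
  by rewrite one_param_exp// mul1r opprK.
have NtE (j : nat) : Nt m ^+ j = Nt (- (m * - j%:R)).
  by rewrite one_param_exp// mulrN opprK.
apply: (@same_absolute_jordan_form_of_bilipschitz _ _ _ _ F G (K * E + K)) => //.
- by rewrite ltr_wpDl// mulr_ge0// ltW.
- move=> j x x'; rewrite MtE NtE; set t : R := - j%:R.
  apply: le_trans (EP _ (- h t) _ _) _.
    by rewrite opprK addrC; exact: hD.
  have [le1 _] := FP t x x'; rewrite mulrDl.
  apply: (@le_trans _ _ (E * (K * `|Mt (- t) *m (x - x')|))).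
    by rewrite ler_wpM2l.
  by rewrite mulrA [E * K]mulrC lerDl mulr_ge0// ltW.
move=> j x x'; rewrite MtE NtE; set t : R := - j%:R.
have [_ le2] := FP t x x'; apply: le_trans le2 _; rewrite mulrDl.
apply: (@le_trans _ _ (K * (E * `|Nt (- (m * t)) *m (F x - F x')|))).
  rewrite ler_pM2l//; apply: EP.
  by rewrite opprK addrC distrC; exact: hD.
by rewrite mulrA lerDl mulr_ge0// ltW.
Qed.
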